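(* Let $\mathcal C$ and $\mathcal D$ be small bicategories and $\mathcal K$ a 2-category. The following are equivalent notions (i.e. the three kinds of data are canonically in bijection with each other): (1) a generalized distributive law, i.e. a 2-functor $\Gamma\colon\overline{\mathcal C}\otimes_l\overline{\mathcal D}\to\mathcal K$; (2) a lax functor $\mathcal D\rightsquigarrow\mathrm{Lax}[\mathcal C,\mathcal K]_l$; (3) a lax functor $\mathcal C\rightsquigarrow\mathrm{Lax}[\mathcal D,\mathcal K]_c$.
   Context: $\mathrm{Lax}[\mathcal C,\mathcal K]_l$ (resp. $\mathrm{Lax}[\mathcal C,\mathcal K]_c$) is the 2-category of lax functors $\mathcal C\rightsquigarrow\mathcal K$, lax (resp. oplax) natural transformations, and modifications. Convention: a lax natural transformation $\alpha\colon F\to G$ has 2-cells $\alpha_f\colon Gf.\alpha_A\Rightarrow\alpha_B.Ff$ for $f\colon A\to B$; an oplax one has 2-cells in the opposite direction. **Lax functor classifier.** $\overline{\mathcal C}$ is the 2-category equipped with a lax functor $p\colon\mathcal C\rightsquigarrow\overline{\mathcal C}$ such that, for every 2-category $\mathcal K$, $G\mapsto Gp$ is a bijection from 2-functors $\overline{\mathcal C}\to\mathcal K$ to lax functors $\mathcal C\rightsquigarrow\mathcal K$ (extending to icons). **Lax Gray tensor product.** For 2-categories $\mathcal A,\mathcal B$, the 2-category $\mathcal A\otimes_l\mathcal B$ is generated by: objects $A\otimes B$; 1-cells $f\otimes B\colon A\otimes B\to A'\otimes B$ and $A\otimes g\colon A\otimes B\to A\otimes B'$ for $f\colon A\to A'$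 in $\mathcal A$, $g\colon B\to B'$ in $\mathcal B$; 2-cells $\alpha\otimes B$, $A\otimes\beta$ for 2-cells $\alpha$ of $\mathcal A$ and $\beta$ of $\mathcal B$, and $\gamma_{f,g}\colon(f\otimes B')(A\otimes g)\Rightarrow(A'\otimes g)(f\otimes B)$; subject to: $-\otimes B$ and $A\otimes-$ are 2-functors; $\gamma_{1_A,g}$ and $\gamma_{f,1_B}$ are identities; $\gamma_{f'f,g}=(\gamma_{f',g}(f\otimes B))\circ((f'\otimes B')\gamma_{f,g})$; $\gamma_{f,g'g}=((A'\otimes g')\gamma_{f,g})\circ(\gamma_{f,g'}(A\otimes g))$; and, for $\alpha\colon f\Rightarrow f'$, $\beta\colon g\Rightarrow g'$, $\gamma_{f',g'}\circ((\alpha\otimes B')(A\otimes\beta))=((A'\otimes\beta)(\alpha\otimes B))\circ\gamma_{f,g}$. *)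

(* Defs.v *)
From Stdlib Require Import ssreflect ssrfun.
From Stdlib Require Import FunctionalExtensionality ProofIrrelevance ClassicalEpsilon.

Set Implicit Arguments.
Unset Strict Implicit.
Unset Printing Implicit Defensive.

Record HomCats := {
  ob : Type;
  hom : ob -> ob -> Type;
  cell : forall A B, hom A B -> hom A B -> Type;
  id2 : forall A B (f : hom A B), cell f f;
  vcomp : forall A B (f g h : hom A B), cell g h -> cell f g -> cell f h;
  id1 : forall A, hom A A;
  comp : forall A B C, hom B C -> hom A B -> hom A C;
  hcomp : forall A B C (g g' : hom B C) (f f' : hom A B),
    cell g g' -> cell f f' -> cell (comp g f) (comp g' f');
  vcomp_idl : forall A B (f g : hom A B) (a : cell f g), vcomp (id2 g) a = a;
  vcomp_idr : forall A B (f g : hom A B) (a : cell f g), vcomp a (id2 f) = a;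
  vcompA : forall A B (f g h k : hom A B) (c : cell h k) (b : cell g h) (a : cell f g),
    vcomp c (vcomp b a) = vcomp (vcomp c b) a;
  hcomp_id2 : forall A B C (g : hom B C) (f : hom A B),
    hcomp (id2 g) (id2 f) = id2 (comp g f);
  hcomp_vcomp : forall A B C (g g' g'' : hom B C) (f f' f'' : hom A B)
      (b' : cell g' g'') (b : cell g g') (a' : cell f' f'') (a : cell f f'),
    hcomp (vcomp b' b) (vcomp a' a) = vcomp (hcomp b' a') (hcomp b a)
}.

Arguments id2 {X A B} f : rename.
Arguments id1 {X} A : rename.
Arguments hom {X} A B : rename.
Arguments cell {X A B} f g : rename.
Arguments vcomp {X A B f g h} b a : rename.
Arguments comp {X A B C} g f : rename.
Arguments hcomp {X A B C g g' f f'} b a : rename.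

Declare Scope cell_scope.
Delimit Scope cell_scope with cell.
Open Scope cell_scope.

Notation "g ∘ f" := (comp g f) (at level 38, right associativity) : cell_scope.
Notation "b ∗ a" := (hcomp b a) (at level 41, right associativity) : cell_scope.
Notation "b • a" := (vcomp b a) (at level 44, right associativity) : cell_scope.
Notation "g ◁ a" := (hcomp (id2 g) a) (at level 40, no associativity) : cell_scope.
Notation "a ▷ f" := (hcomp a (id2 f)) (at level 40, no associativity) : cell_scope.

(** Strictness of a 2-category identifies 1-cells only propositionally, so the
    boundaries of two equal 2-cells need not be convertible.  [a ≡ b] says that
    [a] and [b] are equal as 2-cells together with their boundaries. *)
Record Cell (X : HomCats) (A B : ob X) := pack {
  src : hom A B; tgt : hom A B; the_cell : cell src tgt }.
Arguments pack {X A B src tgt}.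

Notation "a ≡ b" := (pack a = pack b) (at level 70, no associativity) : cell_scope.

Definition cast (X : HomCats) (A B : ob X) (f g f' g' : hom A B)
    (e : f = f') (e' : g = g') (a : cell f g) : cell f' g' :=
  match e in _ = x, e' in _ = y return cell x y with eq_refl, eq_refl => a end.

Definition vcomp_along (X : HomCats) (A B : ob X) (f g g' h : hom A B)
    (e : g = g') (b : cell g' h) (a : cell f g) : cell f h :=
  b • cast eq_refl e a.

Notation "b •[ e ] a" := (vcomp_along e b a)
  (at level 44, right associativity, format "b  •[ e ]  a") : cell_scope.

Definition invertible (X : HomCats) (A B : ob X) (f g : hom A B) (a : cell f g) : Prop :=
  exists b : cell g f, b • a = id2 f /\ a • b = id2 g.

Record Bicat := {
  bicat_homcats :> HomCats;
  lun : forall (A B : ob bicat_homcats) (f : hom A B), cell (id1 B ∘ f) f;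
  run : forall (A B : ob bicat_homcats) (f : hom A B), cell (f ∘ id1 A) f;
  asc : forall (A B C D : ob bicat_homcats) (h : hom C D) (g : hom B C) (f : hom A B),
    cell ((h ∘ g) ∘ f) (h ∘ (g ∘ f));
  lun_invertible : forall (A B : ob bicat_homcats) (f : hom A B), invertible (lun f);
  run_invertible : forall (A B : ob bicat_homcats) (f : hom A B), invertible (run f);
  asc_invertible : forall (A B C D : ob bicat_homcats)
      (h : hom C D) (g : hom B C) (f : hom A B),
    invertible (asc h g f);
  lun_natural : forall (A B : ob bicat_homcats) (f f' : hom A B) (a : cell f f'),
    lun f' • (id1 B ◁ a) = a • lun f;
  run_natural : forall (A B : ob bicat_homcats) (f f' : hom A B) (a : cell f f'),
    run f' • (a ▷ id1 A) = a • run f;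
  asc_natural : forall (A B C D : ob bicat_homcats)
      (h h' : hom C D) (g g' : hom B C) (f f' : hom A B)
      (c : cell h h') (b : cell g g') (a : cell f f'),
    asc h' g' f' • ((c ∗ b) ∗ a) = (c ∗ (b ∗ a)) • asc h g f;
  triangle : forall (A B C : ob bicat_homcats) (g : hom B C) (f : hom A B),
    (g ◁ lun f) • asc g (id1 B) f = run g ▷ f;
  pentagon : forall (A B C D E : ob bicat_homcats)
      (k : hom D E) (h : hom C D) (g : hom B C) (f : hom A B),
    asc k h (g ∘ f) • asc (k ∘ h) g f
    = (k ◁ asc h g f) • asc k (h ∘ g) f • (asc k h g ▷ f)
}.

Arguments lun {C A B} f : rename.
Arguments run {C A B} f : rename.
Arguments asc {C A B C0 D} h g f : rename.

Record TwoCat := {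
  twocat_homcats :> HomCats;
  comp1l : forall (A B : ob twocat_homcats) (f : hom A B), id1 B ∘ f = f;
  comp1r : forall (A B : ob twocat_homcats) (f : hom A B), f ∘ id1 A = f;
  compA : forall (A B C D : ob twocat_homcats) (h : hom C D) (g : hom B C) (f : hom A B),
    (h ∘ g) ∘ f = h ∘ (g ∘ f);
  hcomp1l : forall (A B : ob twocat_homcats) (f f' : hom A B) (a : cell f f'),
    id1 B ◁ a ≡ a;
  hcomp1r : forall (A B : ob twocat_homcats) (f f' : hom A B) (a : cell f f'),
    a ▷ id1 A ≡ a;
  hcompA : forall (A B C D : ob twocat_homcats)
      (h h' : hom C D) (g g' : hom B C) (f f' : hom A B)
      (c : cell h h') (b : cell g g') (a : cell f f'),
    (c ∗ b) ∗ a ≡ c ∗ (b ∗ a)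
}.

Arguments comp1l {K A B} f : rename.
Arguments comp1r {K A B} f : rename.
Arguments compA {K A B C D} h g f : rename.

Section PackedCells.
Context {X : HomCats}.

Lemma pack_inj (A B : ob X) (f g : hom A B) (a b : cell f g) : a ≡ b -> a = b.
Proof.
move=> e.
pose get (x : Cell A B) (p : src x = f) (q : tgt x = g) := cast p q (the_cell x).
have H : forall x (ex : pack a = x) p q, get x p q = a.
  move=> x <- p q; rewrite /get /=.
  by rewrite (proof_irrelevance _ p eq_refl) (proof_irrelevance _ q eq_refl).
by rewrite -(H _ e eq_refl eq_refl).
Qed.

Lemma pack_cast (A B : ob X) (f g f' g' : hom A B) (e : f = f') (e' : g = g') (a : cell f g) :
  cast e e' a ≡ a.
Proof. by case: _ / e; case: _ / e'. Qed.

Definition hT (A B C : ob X) (y : Cell B C) (x : Cell A B) : Cell A C :=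
  pack (the_cell y ∗ the_cell x).

Definition iT (A B : ob X) (f : hom A B) : Cell A B := pack (id2 f).

(* A total extension of vertical composition, with a dummy value on
   non-composable pairs; it is only used inside proofs. *)
Definition vT (A B : ob X) (y x : Cell A B) : Cell A B :=
  match excluded_middle_informative (tgt x = src y) with
  | left e => pack (the_cell y •[e] the_cell x)
  | right _ => y
  end.

Arguments vT : simpl never.
Arguments hT : simpl never.
Arguments iT : simpl never.

Lemma vTE (A B : ob X) (f g h : hom A B) (b : cell g h) (a : cell f g) :
  pack (b • a) = vT (pack b) (pack a).
Proof.
rewrite /vT; case: excluded_middle_informative => //= e.
by rewrite (proof_irrelevance _ e eq_refl).
Qed.

Lemma vTE' (A B : ob X) (f g g' h : hom A B) (e : g = g') (b : cell g' h) (a : cell f g) :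
  pack (b •[e] a) = vT (pack b) (pack a).
Proof. by case: _ / e b => b; rewrite -vTE. Qed.

Lemma hTE (A B C : ob X) (g g' : hom B C) (f f' : hom A B) (b : cell g g') (a : cell f f') :
  pack (b ∗ a) = hT (pack b) (pack a).
Proof. by []. Qed.

Lemma iTE (A B : ob X) (f : hom A B) : pack (id2 f) = iT f.
Proof. by []. Qed.

Lemma src_vT (A B : ob X) (y x : Cell A B) : tgt x = src y -> src (vT y x) = src x.
Proof. by rewrite /vT; case: excluded_middle_informative. Qed.

Lemma tgt_vT (A B : ob X) (y x : Cell A B) : tgt (vT y x) = tgt y.
Proof. by rewrite /vT; case: excluded_middle_informative. Qed.

Lemma vTA (A B : ob X) (z y x : Cell A B) :
  tgt x = src y -> tgt y = src z -> vT z (vT y x) = vT (vT z y) x.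
Proof.
case: x y z => [f g a] [g' h b] [h' k c] /= e e'.
by case: _ / e b => b; case: _ / e' c => c; rewrite -!vTE vcompA.
Qed.

Lemma vT1l (A B : ob X) f (x : Cell A B) : tgt x = f -> vT (iT f) x = x.
Proof. by case: x => [g h a] /= <-; rewrite /iT -vTE vcomp_idl. Qed.

Lemma vT1r (A B : ob X) f (x : Cell A B) : src x = f -> vT x (iT f) = x.
Proof. by case: x => [g h a] /= <-; rewrite /iT -vTE vcomp_idr. Qed.

Lemma hT_id (A B C : ob X) (g : hom B C) (f : hom A B) : hT (iT g) (iT f) = iT (g ∘ f).
Proof. by rewrite -!iTE -hTE hcomp_id2. Qed.

Lemma hT_vT (A B C : ob X) (y' y : Cell B C) (x' x : Cell A B) :
  tgt y = src y' -> tgt x = src x' ->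
  hT (vT y' y) (vT x' x) = vT (hT y' x') (hT y x).
Proof.
case: x y x' y' => [f f' a] [g g' b] [f1 f1' a'] [g1 g1' b'] /= e e'.
case: _ / e b' => b'; case: _ / e' a' => a'.
by rewrite -!vTE -!hTE /= hcomp_vcomp.
Qed.

Lemma hT_vTl (A B C : ob X) (g : hom B C) (x' x : Cell A B) :
  tgt x = src x' -> hT (iT g) (vT x' x) = vT (hT (iT g) x') (hT (iT g) x).
Proof. by move=> e; rewrite -hT_vT // vT1l. Qed.

Lemma hT_vTr (A B C : ob X) (f : hom A B) (x' x : Cell B C) :
  tgt x = src x' -> hT (vT x' x) (iT f) = vT (hT x' (iT f)) (hT x (iT f)).
Proof. by move=> e; rewrite -hT_vT // vT1l. Qed.

Lemma hT_lr (A B C : ob X) (y : Cell B C) (x : Cell A B) :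
  hT y x = vT (hT y (iT (tgt x))) (hT (iT (src y)) x).
Proof. by rewrite -hT_vT // vT1r // vT1l. Qed.

Lemma hT_rl (A B C : ob X) (y : Cell B C) (x : Cell A B) :
  hT y x = vT (hT (iT (tgt y)) x) (hT y (iT (src x))).
Proof. by rewrite -hT_vT // vT1r // vT1l. Qed.

End PackedCells.

Section PackedStrict.
Context {K : TwoCat}.

Lemma hTA (A B C D : ob K) (z : Cell C D) (y : Cell B C) (x : Cell A B) :
  hT (hT z y) x = hT z (hT y x).
Proof. exact: hcompA. Qed.

Lemma hT1l (A B : ob K) (x : Cell A B) : hT (iT (id1 B)) x = x.
Proof. by case: x => f g a; exact: hcomp1l. Qed.

Lemma hT1r (A B : ob K) (x : Cell A B) : hT x (iT (id1 A)) = x.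
Proof. by case: x => f g a; exact: hcomp1r. Qed.

End PackedStrict.

(** 2-functors and lax functors are presented as structures over a fixed map
    on objects, so that several of them can be required to share it. *)
Record TwoFunOn (K L : TwoCat) (F0 : ob K -> ob L) := {
  tf1 : forall A B : ob K, hom A B -> hom (F0 A) (F0 B);
  tf2 : forall (A B : ob K) (f g : hom A B), cell f g -> cell (tf1 f) (tf1 g);
  tf1_id : forall A : ob K, tf1 (id1 A) = id1 (F0 A);
  tf1_comp : forall (A B C : ob K) (g : hom B C) (f : hom A B),
    tf1 (g ∘ f) = tf1 g ∘ tf1 f;
  tf2_id : forall (A B : ob K) (f : hom A B), tf2 (id2 f) = id2 (tf1 f);
  tf2_vcomp : forall (A B : ob K) (f g h : hom A B) (b : cell g h) (a : cell f g),
    tf2 (b • a) = tf2 b • tf2 a;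
  tf2_hcomp : forall (A B C : ob K) (g g' : hom B C) (f f' : hom A B)
      (b : cell g g') (a : cell f f'),
    tf2 (b ∗ a) ≡ tf2 b ∗ tf2 a
}.
Arguments tf1 {K L F0} F {A B} f : rename.
Arguments tf2 {K L F0} F {A B f g} a : rename.
Arguments tf1_id {K L F0} F A : rename.
Arguments tf1_comp {K L F0} F {A B C} g f : rename.

Record TwoFunctor (K L : TwoCat) := {
  tfob :> ob K -> ob L;
  tfon : TwoFunOn tfob
}.
Arguments tfon {K L} F : rename.

Record LaxOn (C : Bicat) (K : TwoCat) (F0 : ob C -> ob K) := {
  lf1 : forall A B : ob C, hom A B -> hom (F0 A) (F0 B);
  lf2 : forall (A B : ob C) (f g : hom A B), cell f g -> cell (lf1 f) (lf1 g);
  lunit : forall A : ob C, cell (id1 (F0 A)) (lf1 (id1 A));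
  lmult : forall (A B D : ob C) (g : hom B D) (f : hom A B),
    cell (lf1 g ∘ lf1 f) (lf1 (g ∘ f));
  lf2_id : forall (A B : ob C) (f : hom A B), lf2 (id2 f) = id2 (lf1 f);
  lf2_vcomp : forall (A B : ob C) (f g h : hom A B) (b : cell g h) (a : cell f g),
    lf2 (b • a) = lf2 b • lf2 a;
  lmult_natural : forall (A B D : ob C) (g g' : hom B D) (f f' : hom A B)
      (b : cell g g') (a : cell f f'),
    lf2 (b ∗ a) • lmult g f = lmult g' f' • (lf2 b ∗ lf2 a);
  lmult_assoc : forall (A B D E : ob C) (h : hom D E) (g : hom B D) (f : hom A B),
    lf2 (asc h g f) • lmult (h ∘ g) f • (lmult h g ▷ lf1 f)
    ≡ lmult h (g ∘ f) • (lf1 h ◁ lmult g f);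
  lmult_lunit : forall (A B : ob C) (f : hom A B),
    lf2 (lun f) • lmult (id1 B) f • (lunit B ▷ lf1 f) ≡ id2 (lf1 f);
  lmult_runit : forall (A B : ob C) (f : hom A B),
    lf2 (run f) • lmult f (id1 A) • (lf1 f ◁ lunit A) ≡ id2 (lf1 f)
}.
Arguments lf1 {C K F0} F {A B} f : rename.
Arguments lf2 {C K F0} F {A B f g} a : rename.
Arguments lunit {C K F0} F A : rename.
Arguments lmult {C K F0} F {A B D} g f : rename.

Record LaxFunctor (C : Bicat) (K : TwoCat) := {
  lfob :> ob C -> ob K;
  lfon :> LaxOn lfob
}.
Arguments lfon {C K} F : rename.

(** Icons relate (lax) functors with the same map on objects. *)
Record LaxIcon (C : Bicat) (K : TwoCat) (F0 : ob C -> ob K) (F G : LaxOn F0) := {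
  lic : forall (A B : ob C) (f : hom A B), cell (lf1 F f) (lf1 G f);
  lic_natural : forall (A B : ob C) (f f' : hom A B) (a : cell f f'),
    lic f' • lf2 F a = lf2 G a • lic f;
  lic_unit : forall A : ob C, lic (id1 A) • lunit F A = lunit G A;
  lic_mult : forall (A B D : ob C) (g : hom B D) (f : hom A B),
    lic (g ∘ f) • lmult F g f = lmult G g f • (lic g ∗ lic f)
}.
Arguments lic {C K F0 F G} i {A B} f : rename.

Record Icon (K L : TwoCat) (F0 : ob K -> ob L) (F G : TwoFunOn F0) := {
  ic : forall (A B : ob K) (f : hom A B), cell (tf1 F f) (tf1 G f);
  ic_natural : forall (A B : ob K) (f f' : hom A B) (a : cell f f'),
    ic f' • tf2 F a = tf2 G a • ic f;
  ic_unit : forall A : ob K, ic (id1 A) ≡ id2 (id1 (F0 A));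
  ic_comp : forall (A B C : ob K) (g : hom B C) (f : hom A B),
    ic (g ∘ f) ≡ ic g ∗ ic f
}.
Arguments ic {K L F0 F G} i {A B} f : rename.

Ltac pk := rewrite ?(vTE, vTE', pack_cast, hTE, iTE).
Ltac bdy :=
  repeat (first [rewrite tgt_vT | rewrite src_vT; [ | solve [bdy]]]);
  rewrite /= ?compA ?comp1l ?comp1r; try reflexivity; try congruence.

Section Actions.
Variables (K L : TwoCat) (F0 : ob K -> ob L) (F : TwoFunOn F0).

Definition tfT (A B : ob K) (x : Cell A B) : Cell (F0 A) (F0 B) := pack (tf2 F (the_cell x)).

Lemma tfTE (A B : ob K) (f g : hom A B) (a : cell f g) : pack (tf2 F a) = tfT (pack a).
Proof. by []. Qed.

Lemma tfT_v (A B : ob K) (y x : Cell A B) :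
  tgt x = src y -> tfT (vT y x) = vT (tfT y) (tfT x).
Proof.
case: x y => [f g a] [g' h b] /= e; case: _ / e b => b.
by rewrite -vTE /tfT /= -vTE tf2_vcomp.
Qed.

Lemma tfT_h (A B C : ob K) (y : Cell B C) (x : Cell A B) : tfT (hT y x) = hT (tfT y) (tfT x).
Proof. exact: tf2_hcomp. Qed.

Lemma tfT_i (A B : ob K) (f : hom A B) : tfT (iT f) = iT (tf1 F f).
Proof. by rewrite /tfT /iT /= tf2_id. Qed.
End Actions.

(** The composite [C ~> K -> L] of a lax functor and a 2-functor. *)
Definition comp_on (C : Bicat) (K L : TwoCat) (G0 : ob K -> ob L) (P0 : ob C -> ob K)
  (G : TwoFunOn G0) (P : LaxOn P0) : LaxOn (fun A => G0 (P0 A)).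
Proof.
unshelve refine {|
  lf1 A B f := tf1 G (lf1 P f);
  lf2 A B f g a := tf2 G (lf2 P a);
  lunit A := cast (tf1_id G _) eq_refl (tf2 G (lunit P A));
  lmult A B D g f := cast (tf1_comp G _ _) eq_refl (tf2 G (lmult P g f)) |}.
- by move=> *; rewrite lf2_id tf2_id.
- by move=> *; rewrite lf2_vcomp tf2_vcomp.
- move=> A B D g g' f f' b a; apply: pack_inj; pk; rewrite !tfTE.
  by rewrite -tfT_h -!tfT_v // -!vTE lmult_natural.
- move=> A B D E h g f; pk; rewrite !tfTE -!tfT_i -!tfT_h -!tfT_v; try by bdy.
  by congr (tfT G _); move: (lmult_assoc P h g f); pk.
- move=> A B f; pk; rewrite !tfTE -!tfT_i -!tfT_h -!tfT_v; try by bdy.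
  by congr (tfT G _); move: (lmult_lunit P f); pk.
- move=> A B f; pk; rewrite !tfTE -!tfT_i -!tfT_h -!tfT_v; try by bdy.
  by congr (tfT G _); move: (lmult_runit P f); pk.
Defined.

Definition comp_lax (C : Bicat) (K L : TwoCat) (G : TwoFunctor K L) (P : LaxFunctor C K) :
  LaxFunctor C L := {| lfon := comp_on (tfon G) P |}.

Definition whisker_icon (C : Bicat) (K L : TwoCat) (G0 : ob K -> ob L) (P0 : ob C -> ob K)
  (G H : TwoFunOn G0) (P : LaxOn P0) (i : Icon G H) : LaxIcon (comp_on G P) (comp_on H P).
Proof.
unshelve refine (@Build_LaxIcon _ _ _ (comp_on G P) (comp_on H P)
  (fun A B f => ic i (lf1 P f)) _ _ _).
- by move=> A B f f' a; rewrite /= ic_natural.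
- move=> A /=; apply: pack_inj; pk.
  rewrite -vTE ic_natural; pk; rewrite ic_unit; pk.
  by rewrite vT1r //= tf1_id.
- move=> A B D g f /=; apply: pack_inj; pk.
  by rewrite -vTE ic_natural; pk; rewrite ic_comp; pk.
Defined.

(** The lax functor classifier of [C]: the 2-category [C̄] with its universal
    lax functor [p : C ~> C̄].  Precomposition with [p] is bijective on
    2-functors and, between 2-functors with the same map on objects, on icons. *)
Record LaxClassifier (C : Bicat) := {
  classifier :> TwoCat;
  cl : LaxFunctor C classifier;
  cl_universal : forall K : TwoCat,
    bijective (fun G : TwoFunctor classifier K => comp_lax G cl);
  cl_universal_icon : forall (K : TwoCat) (G0 : ob classifier -> ob K) (G H : TwoFunOn G0),
    bijective (fun i : Icon G H => whisker_icon cl i)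
}.
Arguments cl {C} c : rename.

(** An interpretation in [K] of the generators of the lax Gray tensor product
    of [A] and [B], satisfying its relations: [gob a b], [gl b] and [gr a]
    interpret [a ⊗ b], [- ⊗ b] and [a ⊗ -]. *)
Record GrayData (A B K : TwoCat) := {
  gob : ob A -> ob B -> ob K;
  gl : forall b : ob B, TwoFunOn (fun a : ob A => gob a b);
  gr : forall a : ob A, TwoFunOn (fun b : ob B => gob a b);
  gam : forall (a a' : ob A) (b b' : ob B) (f : hom a a') (g : hom b b'),
    cell (tf1 (gl b') f ∘ tf1 (gr a) g) (tf1 (gr a') g ∘ tf1 (gl b) f);
  gam_id_l : forall (a : ob A) (b b' : ob B) (g : hom b b'),
    gam (id1 a) g ≡ id2 (tf1 (gr a) g);
  gam_id_r : forall (a a' : ob A) (b : ob B) (f : hom a a'),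
    gam f (id1 b) ≡ id2 (tf1 (gl b) f);
  gam_comp_l : forall (a a' a'' : ob A) (b b' : ob B)
      (f' : hom a' a'') (f : hom a a') (g : hom b b'),
    gam (f' ∘ f) g
    ≡ (gam f' g ▷ tf1 (gl b) f) •[eq_sym (compA _ _ _)] (tf1 (gl b') f' ◁ gam f g);
  gam_comp_r : forall (a a' : ob A) (b b' b'' : ob B)
      (f : hom a a') (g' : hom b' b'') (g : hom b b'),
    gam f (g' ∘ g)
    ≡ (tf1 (gr a') g' ◁ gam f g) •[compA _ _ _] (gam f g' ▷ tf1 (gr a) g);
  gam_natural : forall (a a' : ob A) (b b' : ob B) (f f' : hom a a') (g g' : hom b b')
      (x : cell f f') (y : cell g g'),
    gam f' g' • (tf2 (gl b') x ∗ tf2 (gr a) y)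
    = (tf2 (gr a') y ∗ tf2 (gl b) x) • gam f g
}.
Arguments gob {A B K} u a b : rename.
Arguments gl {A B K} u b : rename.
Arguments gr {A B K} u a : rename.
Arguments gam {A B K} u {a a' b b'} f g : rename.

Definition tf_comp_on (K L M : TwoCat) (G0 : ob L -> ob M) (F0 : ob K -> ob L)
  (G : TwoFunOn G0) (F : TwoFunOn F0) : TwoFunOn (fun A => G0 (F0 A)).
Proof.
unshelve refine {|
  tf1 A B f := tf1 G (tf1 F f);
  tf2 A B f g a := tf2 G (tf2 F a) |}.
- by move=> A; rewrite !tf1_id.
- by move=> *; rewrite !tf1_comp.
- by move=> *; rewrite !tf2_id.
- by move=> *; rewrite !tf2_vcomp.
- by move=> *; pk; rewrite !tfTE; pk; rewrite !tfT_h.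
Defined.

Definition gray_map (A B K L : TwoCat) (F : TwoFunctor K L) (u : GrayData A B K) :
  GrayData A B L.
Proof.
unshelve refine {|
  gob a b := F (gob u a b);
  gl b := tf_comp_on (tfon F) (gl u b);
  gr a := tf_comp_on (tfon F) (gr u a);
  gam a a' b b' f g := cast (tf1_comp _ _ _) (tf1_comp _ _ _) (tf2 (tfon F) (gam u f g)) |}.
- move=> a b b' g /=; pk; rewrite !tfTE gam_id_l; pk.
  by rewrite tfT_i.
- move=> a b b' g /=; pk; rewrite !tfTE gam_id_r; pk.
  by rewrite tfT_i.
- move=> a a' a'' b b' f' f g /=; pk; rewrite !tfTE gam_comp_l; pk.
  by rewrite tfT_v ?tfT_h ?tfT_i //=; bdy.
- move=> a a' b b' b'' f g' g /=; pk; rewrite !tfTE gam_comp_r; pk.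
  by rewrite tfT_v ?tfT_h ?tfT_i //=; bdy.
- move=> a a' b b' f f' g g' x y /=; apply: pack_inj; pk; rewrite !tfTE -!tfT_h -!tfT_v //.
  by congr (tfT _ _); move: (f_equal pack (gam_natural u x y)); pk.
Defined.

(** The lax Gray tensor product: the 2-category presented by these generators
    and relations, that is, the universal interpretation. *)
Record GrayTensor (A B : TwoCat) := {
  tensor :> TwoCat;
  tensor_data : GrayData A B tensor;
  tensor_universal : forall (K : TwoCat) (v : GrayData A B K),
    exists! F : TwoFunctor tensor K, gray_map F tensor_data = v
}.
Arguments tensor_data {A B} g : rename.

Record LaxTrans (C : Bicat) (K : TwoCat) (F G : LaxFunctor C K) := {
  lt_at :> forall A : ob C, hom (F A) (G A);
  lt_cell : forall (A B : ob C) (f : hom A B),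
    cell (lf1 G f ∘ lt_at A) (lt_at B ∘ lf1 F f);
  lt_natural : forall (A B : ob C) (f f' : hom A B) (x : cell f f'),
    (lt_at B ◁ lf2 F x) • lt_cell f = lt_cell f' • (lf2 G x ▷ lt_at A);
  lt_unit : forall A : ob C,
    lt_cell (id1 A) • (lunit G A ▷ lt_at A) ≡ lt_at A ◁ lunit F A;
  lt_mult : forall (A B D : ob C) (g : hom B D) (f : hom A B),
    lt_cell (g ∘ f) • (lmult G g f ▷ lt_at A)
    ≡ (lt_at D ◁ lmult F g f) •[compA _ _ _] (lt_cell g ▷ lf1 F f)
        •[eq_sym (compA _ _ _)] (lf1 G g ◁ lt_cell f)
}.
Arguments lt_cell {C K F G} t {A B} f : rename.

Record OplaxTrans (C : Bicat) (K : TwoCat) (F G : LaxFunctor C K) := {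
  ot_at :> forall A : ob C, hom (F A) (G A);
  ot_cell : forall (A B : ob C) (f : hom A B),
    cell (ot_at B ∘ lf1 F f) (lf1 G f ∘ ot_at A);
  ot_natural : forall (A B : ob C) (f f' : hom A B) (x : cell f f'),
    (lf2 G x ▷ ot_at A) • ot_cell f = ot_cell f' • (ot_at B ◁ lf2 F x);
  ot_unit : forall A : ob C,
    ot_cell (id1 A) • (ot_at A ◁ lunit F A) ≡ lunit G A ▷ ot_at A;
  ot_mult : forall (A B D : ob C) (g : hom B D) (f : hom A B),
    ot_cell (g ∘ f) • (ot_at D ◁ lmult F g f)
    ≡ (lmult G g f ▷ ot_at A) •[eq_sym (compA _ _ _)] (lf1 G g ◁ ot_cell f)
        •[compA _ _ _] (ot_cell g ▷ lf1 F f)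
}.
Arguments ot_cell {C K F G} t {A B} f : rename.

Record LaxMod (C : Bicat) (K : TwoCat) (F G : LaxFunctor C K) (s t : LaxTrans F G) := {
  lm_at :> forall A : ob C, cell (s A) (t A);
  lm_natural : forall (A B : ob C) (f : hom A B),
    (lm_at B ▷ lf1 F f) • lt_cell s f = lt_cell t f • (lf1 G f ◁ lm_at A)
}.

Record OplaxMod (C : Bicat) (K : TwoCat) (F G : LaxFunctor C K) (s t : OplaxTrans F G) := {
  om_at :> forall A : ob C, cell (s A) (t A);
  om_natural : forall (A B : ob C) (f : hom A B),
    (lf1 G f ◁ om_at A) • ot_cell s f = ot_cell t f • (om_at B ▷ lf1 F f)
}.

Ltac fext := repeat (apply: functional_extensionality_dep; intro).

Section LaxTransformations.
Variables (C : Bicat) (K : TwoCat).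
Implicit Types F G H : LaxFunctor C K.

Lemma lt_ext F G (s t : LaxTrans F G) :
  (forall A, s A = t A) -> (forall A B (f : hom A B), lt_cell s f ≡ lt_cell t f) -> s = t.
Proof.
case: s t => [s c n u m] [t c' n' u' m'] /= e.
have {}e : s = t by fext.
case: _ / e c' n' u' m' => c' n' u' m' ec.
have e : c = c' by fext; apply: pack_inj.
case: _ / e n' u' m' => n' u' m'.
by rewrite (proof_irrelevance _ n n') (proof_irrelevance _ u u') (proof_irrelevance _ m m').
Qed.

Lemma lm_ext F G (s t : LaxTrans F G) (m n : LaxMod s t) : (forall A, m A = n A) -> m = n.
Proof.
case: m n => [m c] [n d] /= e.
have {}e : m = n by fext.
by case: _ / e d => d; rewrite (proof_irrelevance _ c d).
Qed.

Lemma lm_natT F G (s t : LaxTrans F G) (m : LaxMod s t) A B (f : hom A B) :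
  vT (hT (pack (m B)) (iT (lf1 F f))) (pack (lt_cell s f))
  = vT (pack (lt_cell t f)) (hT (iT (lf1 G f)) (pack (m A))).
Proof. by move: (f_equal pack (lm_natural m f)); pk. Qed.

Definition lt_id F : LaxTrans F F.
Proof.
unshelve refine {|
  lt_at A := id1 (F A);
  lt_cell A B f := cast (eq_sym (comp1r _)) (eq_sym (comp1l _)) (id2 (lf1 F f)) |}.
- move=> A B f f' x; apply: pack_inj; pk.
  by rewrite hT1l hT1r vT1r // vT1l.
- by move=> A; pk; rewrite hT1l hT1r vT1l.
- move=> A B D g f; pk.
  by rewrite hT1l hT1r vT1l // !hT_id !vT1r.
Defined.

Definition lt_comp F G H (b : LaxTrans G H) (a : LaxTrans F G) : LaxTrans F H.
Proof.
unshelve refine {|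
  lt_at A := b A ∘ a A;
  lt_cell A B f := cast (compA _ _ _) (eq_sym (compA _ _ _))
    ((b B ◁ lt_cell a f) •[compA _ _ _] (lt_cell b f ▷ a A)) |}.
- move=> A B f f' x; apply: pack_inj; pk.
  rewrite -!hT_id.
  have ea := f_equal pack (lt_natural a x).
  have eb := f_equal pack (lt_natural b x).
  move: ea eb; pk => ea eb.
  rewrite hTA vTA; try by bdy.
  rewrite -hT_vTl; try by bdy.
  rewrite ea hT_vTl; try by bdy.
  rewrite -vTA; try by bdy.
  rewrite -[hT (iT (b B)) (hT _ _)]hTA -hT_vTr; try by bdy.
  rewrite eb hT_vTr; try by bdy.
  by rewrite hTA vTA; try by bdy.
- move=> A; pk; rewrite -!hT_id.
  have ea := lt_unit a A.
  have eb := lt_unit b A.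
  move: ea eb; pk => ea eb.
  rewrite -vTA; try by bdy.
  rewrite -[hT _ (hT (iT (b A)) _)]hTA -hT_vTr; try by bdy.
  rewrite eb hTA -hT_vTl; try by bdy.
  by rewrite ea hTA.
- move=> A B D g f; pk; rewrite -!hT_id.
  have ea := lt_mult a g f.
  have eb := lt_mult b g f.
  move: ea eb; pk => ea eb.
  rewrite -vTA; try by bdy.
  rewrite -[hT _ (hT (iT (b A)) _)]hTA -hT_vTr; try by bdy.
  rewrite eb !hT_vTr; try by bdy.
  rewrite hTA vTA; try by bdy.
  rewrite -hT_vTl; try by bdy.
  rewrite ea !hT_vTl ?hT_vTr; try by bdy.
  rewrite !hTA.
  rewrite -!vTA; try by bdy.
  do 2 congr (vT _ _).
  rewrite !vTA; try by bdy.
  congr (vT _ _).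
  rewrite -![hT (iT (b D)) (hT (iT _) _)]hTA -![hT (iT _) (hT (iT (b B)) _)]hTA.
  rewrite !hT_id.
  exact: etrans (esym (hT_rl (pack (lt_cell b g)) (pack (lt_cell a f)))) (hT_lr _ _).
Defined.

Definition lm_id F G (s : LaxTrans F G) : LaxMod s s.
Proof.
unshelve refine {| lm_at A := id2 (s A) |}.
by move=> A B f; rewrite !hcomp_id2 vcomp_idl vcomp_idr.
Defined.

Definition lm_vcomp F G (s t r : LaxTrans F G) (n : LaxMod t r) (m : LaxMod s t) : LaxMod s r.
Proof.
unshelve refine {| lm_at A := n A • m A |}.
move=> A B f; apply: pack_inj; pk.
rewrite hT_vTl ?hT_vTr; try by bdy.
rewrite -vTA; try by bdy.
rewrite lm_natT vTA; try by bdy.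
by rewrite lm_natT -vTA; try by bdy.
Defined.

Definition lm_hcomp F G H (s s' : LaxTrans G H) (t t' : LaxTrans F G)
  (n : LaxMod s s') (m : LaxMod t t') : LaxMod (lt_comp s t) (lt_comp s' t').
Proof.
unshelve refine (@Build_LaxMod _ _ _ _ (lt_comp s t) (lt_comp s' t')
  (fun A => n A ∗ m A) _).
move=> A B f; apply: pack_inj; pk.
rewrite hTA vTA; try by bdy.
rewrite -hT_vT; try by bdy.
rewrite lm_natT vT1r // -[pack (n B)](@vT1l _ _ _ (s' B)) // hT_vT; try by bdy.
rewrite -vTA; try by bdy.
rewrite -hTA -hT_vT; try by bdy.
rewrite lm_natT vT1r // -[pack (m A)](@vT1l _ _ _ (t' A)) // hT_vT; try by bdy.
rewrite (@vT1l _ _ _ (t' A)) // hTA.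
by rewrite vTA; try by bdy.
Defined.

Lemma lt_comp1l F G (s : LaxTrans F G) : lt_comp (lt_id G) s = s.
Proof.
apply: lt_ext => [A|A B f] /=; first exact: comp1l.
by pk; rewrite hT1l hT_id vT1r ?comp1l.
Qed.

Lemma lt_comp1r F G (s : LaxTrans F G) : lt_comp s (lt_id F) = s.
Proof.
apply: lt_ext => [A|A B f] /=; first exact: comp1r.
by pk; rewrite hT1r hT_id vT1l ?comp1r.
Qed.

Lemma lt_compA F G H L (r : LaxTrans H L) (s : LaxTrans G H) (t : LaxTrans F G) :
  lt_comp (lt_comp r s) t = lt_comp r (lt_comp s t).
Proof.
apply: lt_ext => [A|A B f] /=; first exact: compA.
pk; rewrite -!hT_id hT_vTl ?hT_vTr; try by bdy.
by rewrite !hTA vTA; try by bdy.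
Qed.

Definition Lax_l_homcats : HomCats.
Proof.
unshelve refine {|
  ob := LaxFunctor C K;
  hom := @LaxTrans C K;
  cell := @LaxMod C K;
  id2 := lm_id;
  vcomp := lm_vcomp;
  id1 := lt_id;
  comp := lt_comp;
  hcomp := lm_hcomp |}.
- by move=> *; apply: lm_ext => A; apply: vcomp_idl.
- by move=> *; apply: lm_ext => A; apply: vcomp_idr.
- by move=> *; apply: lm_ext => A; apply: vcompA.
- by move=> *; apply: lm_ext => A; apply: hcomp_id2.
- by move=> *; apply: lm_ext => A; apply: hcomp_vcomp.
Defined.

Lemma lm_packE (F G : ob Lax_l_homcats) (s t s' t' : hom F G) (m : cell s t) (m' : cell s' t') :
  s = s' -> t = t' -> (forall A, lm_at m A ≡ lm_at m' A) -> m ≡ m'.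
Proof.
move=> e e'; case: _ / e m' => m'; case: _ / e' m' => m' em.
by congr pack; apply: lm_ext => A; apply: pack_inj.
Qed.

Definition Lax_l : TwoCat.
Proof.
unshelve refine {| twocat_homcats := Lax_l_homcats |}.
- exact: lt_comp1l.
- exact: lt_comp1r.
- exact: lt_compA.
- move=> F G s s' m; apply: lm_packE => [||A]; try exact: lt_comp1l.
  exact: hcomp1l.
- move=> F G s s' m; apply: lm_packE => [||A]; try exact: lt_comp1r.
  exact: hcomp1r.
- move=> F G H L r r' s s' t t' p n m; apply: lm_packE => [||A]; try exact: lt_compA.
  exact: hcompA.
Defined.

End LaxTransformations.

Section OplaxTransformations.
Variables (C : Bicat) (K : TwoCat).
Implicit Types F G H : LaxFunctor C K.

Lemma ot_ext F G (s t : OplaxTrans F G) :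
  (forall A, s A = t A) -> (forall A B (f : hom A B), ot_cell s f ≡ ot_cell t f) -> s = t.
Proof.
case: s t => [s c n u m] [t c' n' u' m'] /= e.
have {}e : s = t by fext.
case: _ / e c' n' u' m' => c' n' u' m' ec.
have e : c = c' by fext; apply: pack_inj.
case: _ / e n' u' m' => n' u' m'.
by rewrite (proof_irrelevance _ n n') (proof_irrelevance _ u u') (proof_irrelevance _ m m').
Qed.

Lemma om_ext F G (s t : OplaxTrans F G) (m n : OplaxMod s t) : (forall A, m A = n A) -> m = n.
Proof.
case: m n => [m c] [n d] /= e.
have {}e : m = n by fext.
by case: _ / e d => d; rewrite (proof_irrelevance _ c d).
Qed.

Lemma om_natT F G (s t : OplaxTrans F G) (m : OplaxMod s t) A B (f : hom A B) :
  vT (hT (iT (lf1 G f)) (pack (m A))) (pack (ot_cell s f))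
  = vT (pack (ot_cell t f)) (hT (pack (m B)) (iT (lf1 F f))).
Proof. by move: (f_equal pack (om_natural m f)); pk. Qed.

Definition ot_id F : OplaxTrans F F.
Proof.
unshelve refine {|
  ot_at A := id1 (F A);
  ot_cell A B f := cast (eq_sym (comp1l _)) (eq_sym (comp1r _)) (id2 (lf1 F f)) |}.
- move=> A B f f' x; apply: pack_inj; pk.
  by rewrite hT1l hT1r vT1r // vT1l.
- by move=> A; pk; rewrite hT1l hT1r vT1l.
- move=> A B D g f; pk.
  by rewrite hT1l hT1r vT1l // !hT_id !vT1r.
Defined.

Definition ot_comp F G H (b : OplaxTrans G H) (a : OplaxTrans F G) : OplaxTrans F H.
Proof.
unshelve refine {|
  ot_at A := b A ∘ a A;
  ot_cell A B f := cast (eq_sym (compA _ _ _)) (compA _ _ _)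
    ((ot_cell b f ▷ a A) •[eq_sym (compA _ _ _)] (b B ◁ ot_cell a f)) |}.
- move=> A B f f' x; apply: pack_inj; pk.
  rewrite -!hT_id.
  have ea := f_equal pack (ot_natural a x).
  have eb := f_equal pack (ot_natural b x).
  move: ea eb; pk => ea eb.
  rewrite -hTA vTA; try by bdy.
  rewrite -hT_vTr; try by bdy.
  rewrite eb hT_vTr; try by bdy.
  rewrite -vTA; try by bdy.
  rewrite hTA -hT_vTl; try by bdy.
  rewrite ea hT_vTl; try by bdy.
  by rewrite hTA vTA; try by bdy.
- move=> A; pk; rewrite -!hT_id.
  have ea := ot_unit a A.
  have eb := ot_unit b A.
  move: ea eb; pk => ea eb.
  rewrite -vTA; try by bdy.
  rewrite hTA -hT_vTl; try by bdy.
  rewrite ea -[hT _ (hT _ (iT (a A)))]hTA -hT_vTr; try by bdy.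
  by rewrite eb hTA.
- move=> A B D g f; pk; rewrite -!hT_id.
  have ea := ot_mult a g f.
  have eb := ot_mult b g f.
  move: ea eb; pk => ea eb.
  rewrite -vTA; try by bdy.
  rewrite [hT (hT _ _) (pack (lmult F g f))]hTA -hT_vTl; try by bdy.
  rewrite ea !hT_vTl; try by bdy.
  rewrite vTA; try by bdy.
  rewrite -[hT (iT (b D)) (hT (pack (lmult G g f)) _)]hTA -hT_vTr; try by bdy.
  rewrite eb !hT_vTr; try by bdy.
  rewrite !hTA.
  rewrite -!vTA; try by bdy.
  do 2 congr (vT _ _).
  rewrite !vTA; try by bdy.
  congr (vT _ _).
  rewrite -![hT (iT (b D)) (hT (iT _) _)]hTA -![hT (iT _) (hT (iT (b B)) _)]hTA.
  rewrite !hT_id.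
  exact: etrans (esym (hT_lr (pack (ot_cell b g)) (pack (ot_cell a f)))) (hT_rl _ _).
Defined.

Definition om_id F G (s : OplaxTrans F G) : OplaxMod s s.
Proof.
unshelve refine {| om_at A := id2 (s A) |}.
by move=> A B f; rewrite !hcomp_id2 vcomp_idl vcomp_idr.
Defined.

Definition om_vcomp F G (s t r : OplaxTrans F G) (n : OplaxMod t r) (m : OplaxMod s t) :
  OplaxMod s r.
Proof.
unshelve refine {| om_at A := n A • m A |}.
move=> A B f; apply: pack_inj; pk.
rewrite hT_vTl ?hT_vTr; try by bdy.
rewrite -vTA; try by bdy.
rewrite om_natT vTA; try by bdy.
by rewrite om_natT -vTA; try by bdy.
Defined.

Definition om_hcomp F G H (s s' : OplaxTrans G H) (t t' : OplaxTrans F G)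
  (n : OplaxMod s s') (m : OplaxMod t t') : OplaxMod (ot_comp s t) (ot_comp s' t').
Proof.
unshelve refine (@Build_OplaxMod _ _ _ _ (ot_comp s t) (ot_comp s' t')
  (fun A => n A ∗ m A) _).
move=> A B f; apply: pack_inj; pk.
rewrite -hTA vTA; try by bdy.
rewrite -hT_vT; try by bdy.
rewrite om_natT vT1r // -[pack (m A)](@vT1l _ _ _ (t' A)) // hT_vT; try by bdy.
rewrite -vTA; try by bdy.
rewrite hTA -hT_vT; try by bdy.
rewrite om_natT vT1r // -[pack (n B)](@vT1l _ _ _ (s' B)) // hT_vT; try by bdy.
rewrite (@vT1l _ _ _ (s' B)) // -hTA.
by rewrite vTA; try by bdy.
Defined.

Lemma ot_comp1l F G (s : OplaxTrans F G) : ot_comp (ot_id G) s = s.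
Proof.
apply: ot_ext => [A|A B f] /=; first exact: comp1l.
by pk; rewrite hT1l hT_id vT1l ?comp1l.
Qed.

Lemma ot_comp1r F G (s : OplaxTrans F G) : ot_comp s (ot_id F) = s.
Proof.
apply: ot_ext => [A|A B f] /=; first exact: comp1r.
by pk; rewrite hT1r hT_id vT1r ?comp1r.
Qed.

Lemma ot_compA F G H L (r : OplaxTrans H L) (s : OplaxTrans G H) (t : OplaxTrans F G) :
  ot_comp (ot_comp r s) t = ot_comp r (ot_comp s t).
Proof.
apply: ot_ext => [A|A B f] /=; first exact: compA.
pk; rewrite -!hT_id hT_vTl ?hT_vTr; try by bdy.
by rewrite !hTA vTA; try by bdy.
Qed.

Definition Lax_c_homcats : HomCats.
Proof.
unshelve refine {|
  ob := LaxFunctor C K;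
  hom := @OplaxTrans C K;
  cell := @OplaxMod C K;
  id2 := om_id;
  vcomp := om_vcomp;
  id1 := ot_id;
  comp := ot_comp;
  hcomp := om_hcomp |}.
- by move=> *; apply: om_ext => A; apply: vcomp_idl.
- by move=> *; apply: om_ext => A; apply: vcomp_idr.
- by move=> *; apply: om_ext => A; apply: vcompA.
- by move=> *; apply: om_ext => A; apply: hcomp_id2.
- by move=> *; apply: om_ext => A; apply: hcomp_vcomp.
Defined.

Lemma om_packE (F G : ob Lax_c_homcats) (s t s' t' : hom F G) (m : cell s t) (m' : cell s' t') :
  s = s' -> t = t' -> (forall A, om_at m A ≡ om_at m' A) -> m ≡ m'.
Proof.
move=> e e'; case: _ / e m' => m'; case: _ / e' m' => m' em.
by congr pack; apply: om_ext => A; apply: pack_inj.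
Qed.

Definition Lax_c : TwoCat.
Proof.
unshelve refine {| twocat_homcats := Lax_c_homcats |}.
- exact: ot_comp1l.
- exact: ot_comp1r.
- exact: ot_compA.
- move=> F G s s' m; apply: om_packE => [||A]; try exact: ot_comp1l.
  exact: hcomp1l.
- move=> F G s s' m; apply: om_packE => [||A]; try exact: ot_comp1r.
  exact: hcomp1r.
- move=> F G H L r r' s s' t t' p n m; apply: om_packE => [||A]; try exact: ot_compA.
  exact: hcompA.
Defined.

End OplaxTransformations.

Section Comparison.
Variables (C D : Bicat) (A B K : TwoCat).
Variables (P : LaxFunctor C A) (Q : LaxFunctor D B) (u : GrayData A B K).

Lemma gam_natT (a a' : ob A) (b b' : ob B) (f f' : hom a a') (g g' : hom b b')
    (x : cell f f') (y : cell g g') :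
  vT (pack (gam u f' g')) (hT (pack (tf2 (gl u b') x)) (pack (tf2 (gr u a) y)))
  = vT (hT (pack (tf2 (gr u a') y)) (pack (tf2 (gl u b) x))) (pack (gam u f g)).
Proof. by move: (f_equal pack (gam_natural u x y)); pk. Qed.

Lemma gam_nat_l (a a' : ob A) (b b' : ob B) (f f' : hom a a') (g : hom b b') (x : cell f f') :
  vT (pack (gam u f' g)) (hT (pack (tf2 (gl u b') x)) (iT (tf1 (gr u a) g)))
  = vT (hT (iT (tf1 (gr u a') g)) (pack (tf2 (gl u b) x))) (pack (gam u f g)).
Proof. by move: (gam_natT x (id2 g)); rewrite !tf2_id. Qed.

Lemma gam_nat_r (a a' : ob A) (b b' : ob B) (f : hom a a') (g g' : hom b b') (y : cell g g') :
  vT (pack (gam u f g')) (hT (iT (tf1 (gl u b') f)) (pack (tf2 (gr u a) y)))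
  = vT (hT (pack (tf2 (gr u a') y)) (iT (tf1 (gl u b) f))) (pack (gam u f g)).
Proof. by move: (gam_natT (id2 f) y); rewrite !tf2_id. Qed.

(** The lax functor [(- ⊗ Q d) P : C ~> K]. *)
Definition slice_l (d : ob D) : LaxFunctor C K :=
  {| lfob := fun c => gob u (P c) (Q d); lfon := comp_on (gl u (Q d)) P |}.

(** The lax functor [(P c ⊗ -) Q : D ~> K]. *)
Definition slice_r (c : ob C) : LaxFunctor D K :=
  {| lfob := fun d => gob u (P c) (Q d); lfon := comp_on (gr u (P c)) Q |}.

Definition slice_l_trans (d d' : ob D) (g : hom d d') : LaxTrans (slice_l d) (slice_l d').
Proof.
unshelve refine (@Build_LaxTrans _ _ (slice_l d) (slice_l d')
  (fun c => lf1 (slice_r c) g) (fun c c' f => gam u (lf1 P f) (lf1 Q g)) _ _ _).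
- by move=> c c' f f' x; apply: pack_inj; pk; rewrite gam_nat_l.
- by move=> c; pk; rewrite gam_nat_l gam_id_l; pk; rewrite vT1r //= tf1_id comp1r.
- move=> c c' c'' f' f; pk.
  by rewrite gam_nat_l gam_comp_l; pk.
Defined.

Definition slice_l_mod (d d' : ob D) (g g' : hom d d') (y : cell g g') :
  LaxMod (slice_l_trans g) (slice_l_trans g').
Proof.
unshelve refine (@Build_LaxMod _ _ _ _ (slice_l_trans g) (slice_l_trans g')
  (fun c => lf2 (slice_r c) y) _).
by move=> c c' f; apply: pack_inj; pk; rewrite -gam_nat_r.
Defined.

Definition slice_l_unit (d : ob D) : LaxMod (lt_id (slice_l d)) (slice_l_trans (id1 d)).
Proof.
unshelve refine (@Build_LaxMod _ _ _ _ (lt_id (slice_l d)) (slice_l_trans (id1 d))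
  (fun c => lunit (slice_r c) d) _).
move=> c c' f; apply: pack_inj; pk.
by rewrite gam_nat_r gam_id_r; pk; rewrite !vT1r //= tf1_id comp1l.
Defined.

Definition slice_l_mult (d d' d'' : ob D) (g' : hom d' d'') (g : hom d d') :
  LaxMod (lt_comp (slice_l_trans g') (slice_l_trans g)) (slice_l_trans (g' ∘ g)).
Proof.
unshelve refine (@Build_LaxMod _ _ _ _
  (lt_comp (slice_l_trans g') (slice_l_trans g)) (slice_l_trans (g' ∘ g))
  (fun c => lmult (slice_r c) g' g) _).
move=> c c' f; apply: pack_inj; pk.
by rewrite gam_nat_r gam_comp_r; pk.
Defined.

(** The lax functor [D ~> Lax_l C K] sending [d] to [(- ⊗ Q d) P], with 2-cells
    [gam (P f) (Q g)], and with the structure of [(P c ⊗ -) Q] at each [c]. *)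
Definition curry_l : LaxFunctor D (Lax_l C K).
Proof.
unshelve refine (@Build_LaxFunctor D (Lax_l C K) slice_l
  (@Build_LaxOn D (Lax_l C K) slice_l slice_l_trans slice_l_mod slice_l_unit slice_l_mult
    _ _ _ _ _ _)).
- by move=> d d' g; apply: lm_ext => c; apply: (lf2_id (slice_r c)).
- by move=> *; apply: lm_ext => c; apply: (lf2_vcomp (slice_r c)).
- by move=> *; apply: lm_ext => c; apply: (lmult_natural (slice_r c)).
- move=> *; apply: lm_packE => [||c] //; first exact: lt_compA.
  exact: (lmult_assoc (slice_r c)).
- move=> *; apply: lm_packE => [||c] //; first exact: lt_comp1l.
  exact: (lmult_lunit (slice_r c)).
- move=> *; apply: lm_packE => [||c] //; first exact: lt_comp1r.
  exact: (lmult_runit (slice_r c)).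
Defined.

Definition slice_r_trans (c c' : ob C) (f : hom c c') : OplaxTrans (slice_r c) (slice_r c').
Proof.
unshelve refine (@Build_OplaxTrans _ _ (slice_r c) (slice_r c')
  (fun d => lf1 (slice_l d) f) (fun d d' g => gam u (lf1 P f) (lf1 Q g)) _ _ _).
- by move=> d d' g g' x; apply: pack_inj; pk; rewrite gam_nat_r.
- by move=> d; pk; rewrite gam_nat_r gam_id_r; pk; rewrite vT1r //= tf1_id comp1l.
- move=> d d' d'' g' g; pk.
  by rewrite gam_nat_r gam_comp_r; pk.
Defined.

Definition slice_r_mod (c c' : ob C) (f f' : hom c c') (x : cell f f') :
  OplaxMod (slice_r_trans f) (slice_r_trans f').
Proof.
unshelve refine (@Build_OplaxMod _ _ _ _ (slice_r_trans f) (slice_r_trans f')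
  (fun d => lf2 (slice_l d) x) _).
by move=> d d' g; apply: pack_inj; pk; rewrite -gam_nat_l.
Defined.

Definition slice_r_unit (c : ob C) : OplaxMod (ot_id (slice_r c)) (slice_r_trans (id1 c)).
Proof.
unshelve refine (@Build_OplaxMod _ _ _ _ (ot_id (slice_r c)) (slice_r_trans (id1 c))
  (fun d => lunit (slice_l d) c) _).
move=> d d' g; apply: pack_inj; pk.
by rewrite gam_nat_l gam_id_l; pk; rewrite !vT1r //= tf1_id comp1r.
Defined.

Definition slice_r_mult (c c' c'' : ob C) (f' : hom c' c'') (f : hom c c') :
  OplaxMod (ot_comp (slice_r_trans f') (slice_r_trans f)) (slice_r_trans (f' ∘ f)).
Proof.
unshelve refine (@Build_OplaxMod _ _ _ _
  (ot_comp (slice_r_trans f') (slice_r_trans f)) (slice_r_trans (f' ∘ f))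
  (fun d => lmult (slice_l d) f' f) _).
move=> d d' g; apply: pack_inj; pk.
by rewrite gam_nat_l gam_comp_l; pk.
Defined.

(** The lax functor [C ~> Lax_c D K] sending [c] to [(P c ⊗ -) Q], with 2-cells
    [gam (P f) (Q g)], and with the structure of [(- ⊗ Q d) P] at each [d]. *)
Definition curry_c : LaxFunctor C (Lax_c D K).
Proof.
unshelve refine (@Build_LaxFunctor C (Lax_c D K) slice_r
  (@Build_LaxOn C (Lax_c D K) slice_r slice_r_trans slice_r_mod slice_r_unit slice_r_mult
    _ _ _ _ _ _)).
- by move=> c c' f; apply: om_ext => d; apply: (lf2_id (slice_l d)).
- by move=> *; apply: om_ext => d; apply: (lf2_vcomp (slice_l d)).
- by move=> *; apply: om_ext => d; apply: (lmult_natural (slice_l d)).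
- move=> *; apply: om_packE => [||d] //; first exact: ot_compA.
  exact: (lmult_assoc (slice_l d)).
- move=> *; apply: om_packE => [||d] //; first exact: ot_comp1l.
  exact: (lmult_lunit (slice_l d)).
- move=> *; apply: om_packE => [||d] //; first exact: ot_comp1r.
  exact: (lmult_runit (slice_l d)).
Defined.

End Comparison.

Definition GenDistLaw (C D : Bicat) (K : TwoCat) (Cb : LaxClassifier C) (Db : LaxClassifier D)
  (T : GrayTensor Cb Db) : Type := TwoFunctor T K.

Section DistributiveLaws.
Variables (C D : Bicat) (K : TwoCat) (Cb : LaxClassifier C) (Db : LaxClassifier D).
Variable T : GrayTensor Cb Db.

Definition law_to_lax_l (Gamma : GenDistLaw K T) : LaxFunctor D (Lax_l C K) :=
  curry_l (cl Cb) (cl Db) (gray_map Gamma (tensor_data T)).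

Definition law_to_lax_c (Gamma : GenDistLaw K T) : LaxFunctor C (Lax_c D K) :=
  curry_c (cl Cb) (cl Db) (gray_map Gamma (tensor_data T)).

End DistributiveLaws.

(* Main.v *)
From Stdlib Require Import ssreflect ssrfun.
From Stdlib Require Import FunctionalExtensionality ProofIrrelevance ClassicalEpsilon.
(* Imported last, so that compA is the associativity of 1-cells. *)
Require Import Defs.

(** Both [D ~> Lax_l C K] and [C ~> Lax_c D K] are curried forms of one
    symmetric notion, a lax functor of two variables ([Bilax]): a family of lax
    functors in each variable, and 2-cells relating the two, subject to
    equations that are at once those of lax transformations in [C] and
    modifications in [D], and those of modifications in [C] and oplax
    transformations in [D].  Hence the two kinds of lax functors are in
    bijection ([rowsK], [of_rowsK], [colsK], [of_colsK]).

    An interpretation [u] of the Gray generators on 2-categories [A] and [B] is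
    the same notion with both variables strict.  By the universal property of
    the tensor product ([gray_map_bij]) it remains to see that restriction along
    the classifying lax functors [C ~> C̄] and [D ~> D̄] is bijective from such
    interpretations to two-variable lax functors, and this is done one variable
    at a time.  With the first variable strict, a two-variable lax functor is a
    2-functor [A -> Lax_c D K], so for [A := C̄] the universal property of [C̄]
    extends along the first variable ([curry_c_bij]).  For the second variable,
    [A -> Lax_c D K] is first seen as a lax functor out of the bicategory
    [bicat_of A], so that it can be recurried as [D ~> Lax_l (bicat_of A) K];
    the universal property of [D̄] extends this to a 2-functor
    [D̄ -> Lax_l (bicat_of A) K] ([two_curry_c_bij]).  The values of the latter
    are strict, because every object of [D̄] comes from [D] ([cl_surjective]),
    and a 2-functor into [Lax_l (bicat_of A) K] with strict values is exactly an
    interpretation of the Gray generators ([two_curry_l_inj],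
    [two_curry_l_surj]).

    Structures of (lax) functors are compared over a definitionally equal map on
    objects: equality of 2-cells up to boundary then suffices, and nothing has to
    be transported between hom-categories. *)

Set Implicit Arguments.
Unset Strict Implicit.
Unset Printing Implicit Defensive.

(** * Extensionality *)

Lemma lax_on_ext (C : Bicat) (K : TwoCat) (F0 : ob C -> ob K) (F G : LaxOn F0) :
  (forall A B (f : hom A B), lf1 F f = lf1 G f) ->
  (forall A B (f g : hom A B) (a : cell f g), lf2 F a ≡ lf2 G a) ->
  (forall A, lunit F A ≡ lunit G A) ->
  (forall A B D (g : hom B D) (f : hom A B), lmult F g f ≡ lmult G g f) -> F = G.
Proof.
case: F G => [F1 F2 Fu Fm p1 p2 p3 p4 p5 p6] [G1 G2 Gu Gm q1 q2 q3 q4 q5 q6] /= e1 e2 eu em.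
have {}e1 : F1 = G1 by fext.
case: _ / e1 G2 Gu Gm e2 eu em q1 q2 q3 q4 q5 q6 => G2 Gu Gm e2 eu em.
have {}e2 : F2 = G2 by fext; apply: pack_inj.
have {}eu : Fu = Gu by fext; apply: pack_inj.
have {}em : Fm = Gm by fext; apply: pack_inj.
case: _ / e2; case: _ / eu; case: _ / em => *.
by f_equal; apply: proof_irrelevance.
Qed.

Lemma two_fun_on_ext (K L : TwoCat) (F0 : ob K -> ob L) (F G : TwoFunOn F0) :
  (forall A B (f : hom A B), tf1 F f = tf1 G f) ->
  (forall A B (f g : hom A B) (a : cell f g), tf2 F a ≡ tf2 G a) -> F = G.
Proof.
case: F G => [F1 F2 p1 p2 p3 p4 p5] [G1 G2 q1 q2 q3 q4 q5] /= e1 e2.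
have {}e1 : F1 = G1 by fext.
case: _ / e1 G2 e2 q1 q2 q3 q4 q5 => G2 e2.
have {}e2 : F2 = G2 by fext; apply: pack_inj.
case: _ / e2 => *.
by f_equal; apply: proof_irrelevance.
Qed.

(** Evaluation at an object, on 2-cells with their boundaries: rewriting a
    transported modification before evaluating it discards the transport. *)
Definition lm_eval (C : Bicat) (K : TwoCat) (F G : ob (Lax_l C K)) (x : Cell F G) (c : ob C) :
    Cell (lfob F c) (lfob G c) :=
  pack (lm_at (the_cell x) c).

Definition om_eval (D : Bicat) (K : TwoCat) (F G : ob (Lax_c D K)) (x : Cell F G) (d : ob D) :
    Cell (lfob F d) (lfob G d) :=
  pack (om_at (the_cell x) d).

Lemma lax_on_ext_l (C D : Bicat) (K : TwoCat) (F0 : ob D -> ob (Lax_l C K)) (F G : LaxOn F0) :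
  (forall d d' (g : hom d d') c, lt_at (lf1 F g) c = lt_at (lf1 G g) c) ->
  (forall d d' (g : hom d d') c c' (f : hom c c'),
    lt_cell (lf1 F g) f ≡ lt_cell (lf1 G g) f) ->
  (forall d d' (g g' : hom d d') (y : cell g g') c, lm_at (lf2 F y) c ≡ lm_at (lf2 G y) c) ->
  (forall d c, lm_eval (pack (lunit F d)) c = lm_eval (pack (lunit G d)) c) ->
  (forall d d' d'' (g' : hom d' d'') (g : hom d d') c,
    lm_eval (pack (lmult F g' g)) c = lm_eval (pack (lmult G g' g)) c) -> F = G.
Proof.
move=> e0 e1 e2 eu em.
have {e0}{}e1 : forall d d' (g : hom d d'), lf1 F g = lf1 G g.
  by move=> d d' g; apply: lt_ext => *; [apply: e0 | apply: e1].
apply: lax_on_ext => [//|x y g g' a|x|x y z g f].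
- by apply: lm_packE => // z; apply: e2.
- by apply: lm_packE => [//||z]; [apply: e1 | apply: eu].
- by apply: lm_packE => [||t]; [rewrite !e1 | apply: e1 | apply: em].
Qed.

Lemma lax_on_ext_c (C D : Bicat) (K : TwoCat) (F0 : ob C -> ob (Lax_c D K)) (F G : LaxOn F0) :
  (forall c c' (f : hom c c') d, ot_at (lf1 F f) d = ot_at (lf1 G f) d) ->
  (forall c c' (f : hom c c') d d' (g : hom d d'),
    ot_cell (lf1 F f) g ≡ ot_cell (lf1 G f) g) ->
  (forall c c' (f f' : hom c c') (x : cell f f') d, om_at (lf2 F x) d ≡ om_at (lf2 G x) d) ->
  (forall c d, om_eval (pack (lunit F c)) d = om_eval (pack (lunit G c)) d) ->
  (forall c c' c'' (f' : hom c' c'') (f : hom c c') d,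
    om_eval (pack (lmult F f' f)) d = om_eval (pack (lmult G f' f)) d) -> F = G.
Proof.
move=> e0 e1 e2 eu em.
have {e0}{}e1 : forall c c' (f : hom c c'), lf1 F f = lf1 G f.
  by move=> c c' f; apply: ot_ext => *; [apply: e0 | apply: e1].
apply: lax_on_ext => [//|x y g g' a|x|x y z g f].
- by apply: om_packE => // z; apply: e2.
- by apply: om_packE => [//||z]; [apply: e1 | apply: eu].
- by apply: om_packE => [||t]; [rewrite !e1 | apply: e1 | apply: em].
Qed.

Lemma two_fun_on_ext_l (C : Bicat) (B K : TwoCat) (F0 : ob B -> ob (Lax_l C K))
    (F G : TwoFunOn F0) :
  (forall b b' (g : hom b b') c, lt_at (tf1 F g) c = lt_at (tf1 G g) c) ->
  (forall b b' (g : hom b b') c c' (f : hom c c'),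
    lt_cell (tf1 F g) f ≡ lt_cell (tf1 G g) f) ->
  (forall b b' (g g' : hom b b') (y : cell g g') c,
    lm_at (tf2 F y) c ≡ lm_at (tf2 G y) c) -> F = G.
Proof.
move=> e0 e1 e2.
have {e0}{}e1 : forall b b' (g : hom b b'), tf1 F g = tf1 G g.
  by move=> b b' g; apply: lt_ext => *; [apply: e0 | apply: e1].
by apply: two_fun_on_ext => // *; apply: lm_packE.
Qed.

Lemma lax_functor_inj (C : Bicat) (K : TwoCat) (F0 : ob C -> ob K) (F G : LaxOn F0) :
  Build_LaxFunctor F = Build_LaxFunctor G -> F = G.
Proof.
move=> e; apply: (@inj_pair2 _ (fun F0 => @LaxOn C K F0)).
exact: (f_equal (fun F => existT (fun F0 => @LaxOn C K F0) (lfob F) (lfon F)) e).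
Qed.

Lemma two_functor_inj (K L : TwoCat) (F0 : ob K -> ob L) (F G : TwoFunOn F0) :
  Build_TwoFunctor F = Build_TwoFunctor G -> F = G.
Proof.
move=> e; apply: (@inj_pair2 _ (fun F0 => @TwoFunOn K L F0)).
exact: (f_equal (fun F => existT (fun F0 => @TwoFunOn K L F0) (tfob F) (tfon F)) e).
Qed.

(** Rebuilding a family of lax functors from its components makes its object maps
    definitionally visible, which is what comparison over a fixed map needs. *)
Lemma lax_functor_eta (I : Type) (C : Bicat) (K : TwoCat) (G : I -> LaxFunctor C K) :
  exists (G0 : I -> ob C -> ob K) (G1 : forall i, LaxOn (G0 i)),
    G = fun i => Build_LaxFunctor (G1 i).
Proof.
exists (fun i => lfob (G i)), (fun i => lfon (G i)).
by apply: functional_extensionality => i; case: (G i).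
Qed.

Lemma inj_surj_bij (X Y : Type) (f : X -> Y) :
  injective f -> (forall y, exists x, f x = y) -> bijective f.
Proof.
move=> fI fS; have g y := constructive_indefinite_description _ (fS y).
exists (fun y => proj1_sig (g y)) => [x|y]; last exact: (proj2_sig (g y)).
by apply: fI; exact: (proj2_sig (g (f x))).
Qed.

(** * Lax functors of two variables *)

(** A lax functor of two variables.  Read along [C], the first three equations make
    [bg] at a fixed [g] a lax transformation, and the last three make the 2-cells,
    units and multiplications of [br] modifications; read along [D], the last three
    make [bg] at a fixed [f] an oplax transformation, and the first three make the
    2-cells, units and multiplications of [bl] modifications. *)
Record Bilax (C D : Bicat) (K : TwoCat) := {
  bob : ob C -> ob D -> ob K;
  bl : forall d, LaxOn (fun c => bob c d);
  br : forall c, LaxOn (fun d => bob c d);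
  bg : forall (c c' : ob C) (d d' : ob D) (f : hom c c') (g : hom d d'),
    cell (lf1 (bl d') f ∘ lf1 (br c) g) (lf1 (br c') g ∘ lf1 (bl d) f);
  bg_natural_l : forall (c c' : ob C) (d d' : ob D) (f f' : hom c c') (g : hom d d')
      (x : cell f f'),
    (lf1 (br c') g ◁ lf2 (bl d) x) • bg f g = bg f' g • (lf2 (bl d') x ▷ lf1 (br c) g);
  bg_unit_l : forall (c : ob C) (d d' : ob D) (g : hom d d'),
    bg (id1 c) g • (lunit (bl d') c ▷ lf1 (br c) g) ≡ lf1 (br c) g ◁ lunit (bl d) c;
  bg_mult_l : forall (c c' c'' : ob C) (d d' : ob D)
      (f' : hom c' c'') (f : hom c c') (g : hom d d'),
    bg (f' ∘ f) g • (lmult (bl d') f' f ▷ lf1 (br c) g)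
    ≡ (lf1 (br c'') g ◁ lmult (bl d) f' f) •[compA _ _ _] (bg f' g ▷ lf1 (bl d) f)
        •[eq_sym (compA _ _ _)] (lf1 (bl d') f' ◁ bg f g);
  bg_natural_r : forall (c c' : ob C) (d d' : ob D) (f : hom c c') (g g' : hom d d')
      (y : cell g g'),
    (lf2 (br c') y ▷ lf1 (bl d) f) • bg f g = bg f g' • (lf1 (bl d') f ◁ lf2 (br c) y);
  bg_unit_r : forall (c c' : ob C) (d : ob D) (f : hom c c'),
    bg f (id1 d) • (lf1 (bl d) f ◁ lunit (br c) d) ≡ lunit (br c') d ▷ lf1 (bl d) f;
  bg_mult_r : forall (c c' : ob C) (d d' d'' : ob D)
      (f : hom c c') (g' : hom d' d'') (g : hom d d'),
    bg f (g' ∘ g) • (lf1 (bl d'') f ◁ lmult (br c) g' g)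
    ≡ (lmult (br c') g' g ▷ lf1 (bl d) f) •[eq_sym (compA _ _ _)] (lf1 (br c') g' ◁ bg f g)
        •[compA _ _ _] (bg f g' ▷ lf1 (br c) g)
}.
Arguments bob {C D K} w c d : rename.
Arguments bl {C D K} w d : rename.
Arguments br {C D K} w c : rename.
Arguments bg {C D K} w {c c' d d'} f g : rename.

Lemma bilax_ext (C D : Bicat) (K : TwoCat) (b0 : ob C -> ob D -> ob K)
    (l l' : forall d, LaxOn (fun c => b0 c d)) (r r' : forall c, LaxOn (fun d => b0 c d))
    g n1 u1 m1 n2 u2 m2 g' n1' u1' m1' n2' u2' m2' :
  (forall d, l d = l' d) -> (forall c, r c = r' c) ->
  (forall c c' d d' (f : hom c c') (h : hom d d'), g c c' d d' f h ≡ g' c c' d d' f h) ->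
  @Build_Bilax C D K b0 l r g n1 u1 m1 n2 u2 m2
  = @Build_Bilax C D K b0 l' r' g' n1' u1' m1' n2' u2' m2'.
Proof.
move=> el er.
have {}el : l = l' by fext.
have {}er : r = r' by fext.
case: _ / el g' n1' u1' m1' n2' u2' m2'; case: _ / er => g' n1' u1' m1' n2' u2' m2' eg.
have {}eg : g = g' by fext; apply: pack_inj.
case: _ / eg n1' u1' m1' n2' u2' m2' => *.
by f_equal; apply: proof_irrelevance.
Qed.

Section Curry.
Variables (C D : Bicat) (K : TwoCat).
Implicit Type w : Bilax C D K.

Definition row w (d : ob D) : LaxFunctor C K := Build_LaxFunctor (bl w d).
Definition col w (c : ob C) : LaxFunctor D K := Build_LaxFunctor (br w c).

Definition row_trans w (d d' : ob D) (g : hom d d') : LaxTrans (row w d) (row w d') :=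
  @Build_LaxTrans _ _ (row w d) (row w d') (fun c => lf1 (br w c) g)
    (fun c c' f => bg w f g) (fun c c' f f' x => bg_natural_l w g x)
    (fun c => bg_unit_l w c g) (fun c c' c'' f' f => bg_mult_l w f' f g).

Definition col_trans w (c c' : ob C) (f : hom c c') : OplaxTrans (col w c) (col w c') :=
  @Build_OplaxTrans _ _ (col w c) (col w c') (fun d => lf1 (bl w d) f)
    (fun d d' g => bg w f g) (fun d d' g g' y => bg_natural_r w f y)
    (fun d => bg_unit_r w d f) (fun d d' d'' g' g => bg_mult_r w f g' g).

Definition row_mod w (d d' : ob D) (g g' : hom d d') (y : cell g g') :
  LaxMod (row_trans w g) (row_trans w g') :=
  @Build_LaxMod _ _ _ _ (row_trans w g) (row_trans w g') (fun c => lf2 (br w c) y)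
    (fun c c' f => bg_natural_r w f y).

Definition col_mod w (c c' : ob C) (f f' : hom c c') (x : cell f f') :
  OplaxMod (col_trans w f) (col_trans w f') :=
  @Build_OplaxMod _ _ _ _ (col_trans w f) (col_trans w f') (fun d => lf2 (bl w d) x)
    (fun d d' g => bg_natural_l w g x).

(** The unit equation of the oplax transformations says that the units of [br] form
    a modification; below, the multiplication equation does the same for the
    multiplications, and dually for the columns. *)
Definition row_unit w (d : ob D) : LaxMod (lt_id (row w d)) (row_trans w (id1 d)).
Proof.
unshelve refine (@Build_LaxMod _ _ _ _ (lt_id (row w d)) (row_trans w (id1 d))
  (fun c => lunit (br w c) d) _).
move=> c c' f; apply: pack_inj; move: (bg_unit_r w d f); pk => /= ->.
by rewrite vT1r /= ?comp1l.
Defined.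

Definition col_unit w (c : ob C) : OplaxMod (ot_id (col w c)) (col_trans w (id1 c)).
Proof.
unshelve refine (@Build_OplaxMod _ _ _ _ (ot_id (col w c)) (col_trans w (id1 c))
  (fun d => lunit (bl w d) c) _).
move=> d d' g; apply: pack_inj; move: (bg_unit_l w c g); pk => /= ->.
by rewrite vT1r /= ?comp1r.
Defined.

Definition row_mult w (d d' d'' : ob D) (g' : hom d' d'') (g : hom d d') :
  LaxMod (lt_comp (row_trans w g') (row_trans w g)) (row_trans w (g' ∘ g)).
Proof.
unshelve refine (@Build_LaxMod _ _ _ _
  (lt_comp (row_trans w g') (row_trans w g)) (row_trans w (g' ∘ g))
  (fun c => lmult (br w c) g' g) _).
by move=> c c' f; apply: pack_inj; move: (bg_mult_r w f g' g); pk => /= ->.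
Defined.

Definition col_mult w (c c' c'' : ob C) (f' : hom c' c'') (f : hom c c') :
  OplaxMod (ot_comp (col_trans w f') (col_trans w f)) (col_trans w (f' ∘ f)).
Proof.
unshelve refine (@Build_OplaxMod _ _ _ _
  (ot_comp (col_trans w f') (col_trans w f)) (col_trans w (f' ∘ f))
  (fun d => lmult (bl w d) f' f) _).
by move=> d d' g; apply: pack_inj; move: (bg_mult_l w f' f g); pk => /= ->.
Defined.

(** Equations between modifications hold objectwise, where they are the axioms of
    the lax functors [br w c]; only the boundaries, strict in [Lax_l], need care. *)
Definition rows w : LaxFunctor D (Lax_l C K).
Proof.
unshelve refine (@Build_LaxFunctor D (Lax_l C K) (row w)
  (@Build_LaxOn D (Lax_l C K) (row w) (row_trans w) (row_mod w) (row_unit w) (row_mult w)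
    _ _ _ _ _ _)).
- by move=> *; apply: lm_ext => c; apply: (lf2_id (br w c)).
- by move=> *; apply: lm_ext => c; apply: (lf2_vcomp (br w c)).
- by move=> *; apply: lm_ext => c; apply: (lmult_natural (br w c)).
- move=> *; apply: lm_packE => [||c] //; first exact: lt_compA.
  exact: (lmult_assoc (br w c)).
- move=> *; apply: lm_packE => [||c] //; first exact: lt_comp1l.
  exact: (lmult_lunit (br w c)).
- move=> *; apply: lm_packE => [||c] //; first exact: lt_comp1r.
  exact: (lmult_runit (br w c)).
Defined.

Definition cols w : LaxFunctor C (Lax_c D K).
Proof.
unshelve refine (@Build_LaxFunctor C (Lax_c D K) (col w)
  (@Build_LaxOn C (Lax_c D K) (col w) (col_trans w) (col_mod w) (col_unit w) (col_mult w)
    _ _ _ _ _ _)).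
- by move=> *; apply: om_ext => d; apply: (lf2_id (bl w d)).
- by move=> *; apply: om_ext => d; apply: (lf2_vcomp (bl w d)).
- by move=> *; apply: om_ext => d; apply: (lmult_natural (bl w d)).
- move=> *; apply: om_packE => [||d] //; first exact: ot_compA.
  exact: (lmult_assoc (bl w d)).
- move=> *; apply: om_packE => [||d] //; first exact: ot_comp1l.
  exact: (lmult_lunit (bl w d)).
- move=> *; apply: om_packE => [||d] //; first exact: ot_comp1r.
  exact: (lmult_runit (bl w d)).
Defined.

(** Conversely, evaluation at an object turns the axioms of a lax functor into
    [Lax_l C K] into those of the lax functors [of_rows_br], and the modification
    equations of its structure 2-cells into the oplax half of the equations. *)
Section OfRows.
Variable H : LaxFunctor D (Lax_l C K).

Definition of_rows_br (c : ob C) : LaxOn (fun d => lfob (lfob H d) c).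
Proof.
unshelve refine (@Build_LaxOn D K (fun d => lfob (lfob H d) c)
  (fun d d' g => lt_at (lf1 (lfon H) g) c) (fun d d' g g' y => lm_at (lf2 (lfon H) y) c)
  (fun d => lm_at (lunit (lfon H) d) c)
  (fun d d' d'' g' g => lm_at (lmult (lfon H) g' g) c) _ _ _ _ _ _).
- by move=> d d' g; rewrite lf2_id.
- by move=> d d' g g' g'' y' y; rewrite lf2_vcomp.
- move=> d d' d'' g g' f f' b a.
  exact: (f_equal (fun m => lm_at m c) (lmult_natural (lfon H) b a)).
- move=> d d' d'' d3 h g f.
  exact: (f_equal (fun m => lm_eval m c) (lmult_assoc (lfon H) h g f)).
- by move=> d d' f; exact: (f_equal (fun m => lm_eval m c) (lmult_lunit (lfon H) f)).
- by move=> d d' f; exact: (f_equal (fun m => lm_eval m c) (lmult_runit (lfon H) f)).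
Defined.

Definition of_rows : Bilax C D K.
Proof.
unshelve refine (@Build_Bilax C D K (fun c d => lfob (lfob H d) c)
  (fun d => lfon (lfob H d)) of_rows_br
  (fun c c' d d' f g => lt_cell (lf1 (lfon H) g) f) _ _ _ _ _ _).
- by move=> c c' d d' f f' g x; exact: (lt_natural (lf1 (lfon H) g) x).
- by move=> c d d' g; exact: (lt_unit (lf1 (lfon H) g) c).
- by move=> c c' c'' d d' f' f g; exact: (lt_mult (lf1 (lfon H) g) f' f).
- by move=> c c' d d' f g g' y; exact: (lm_natural (lf2 (lfon H) y) f).
- move=> c c' d f.
  move: (f_equal pack (lm_natural (lunit (lfon H) d) f)); pk => /= <-.
  by rewrite vT1r /= ?comp1l ?comp1r.
- move=> c c' d d' d'' f g' g.
  by move: (f_equal pack (lm_natural (lmult (lfon H) g' g) f)); pk => /= <-.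
Defined.
End OfRows.

Section OfCols.
Variable H : LaxFunctor C (Lax_c D K).

Definition of_cols_bl (d : ob D) : LaxOn (fun c => lfob (lfob H c) d).
Proof.
unshelve refine (@Build_LaxOn C K (fun c => lfob (lfob H c) d)
  (fun c c' f => ot_at (lf1 (lfon H) f) d) (fun c c' f f' x => om_at (lf2 (lfon H) x) d)
  (fun c => om_at (lunit (lfon H) c) d)
  (fun c c' c'' f' f => om_at (lmult (lfon H) f' f) d) _ _ _ _ _ _).
- by move=> c c' f; rewrite lf2_id.
- by move=> c c' f f' f'' x' x; rewrite lf2_vcomp.
- move=> c c' c'' g g' f f' b a.
  exact: (f_equal (fun m => om_at m d) (lmult_natural (lfon H) b a)).
- move=> c c' c'' c3 h g f.
  exact: (f_equal (fun m => om_eval m d) (lmult_assoc (lfon H) h g f)).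
- by move=> c c' f; exact: (f_equal (fun m => om_eval m d) (lmult_lunit (lfon H) f)).
- by move=> c c' f; exact: (f_equal (fun m => om_eval m d) (lmult_runit (lfon H) f)).
Defined.

Definition of_cols : Bilax C D K.
Proof.
unshelve refine (@Build_Bilax C D K (fun c d => lfob (lfob H c) d)
  of_cols_bl (fun c => lfon (lfob H c))
  (fun c c' d d' f g => ot_cell (lf1 (lfon H) f) g) _ _ _ _ _ _).
- by move=> c c' d d' f f' g x; exact: (om_natural (lf2 (lfon H) x) g).
- move=> c d d' g.
  move: (f_equal pack (om_natural (lunit (lfon H) c) g)); pk => /= <-.
  by rewrite vT1r /= ?comp1l ?comp1r.
- move=> c c' c'' d d' f' f g.
  by move: (f_equal pack (om_natural (lmult (lfon H) f' f) g)); pk => /= <-.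
- by move=> c c' d d' f g g' y; exact: (ot_natural (lf1 (lfon H) f) y).
- by move=> c c' d f; exact: (ot_unit (lf1 (lfon H) f) d).
- by move=> c c' d d' d'' f g' g; exact: (ot_mult (lf1 (lfon H) f) g' g).
Defined.
End OfCols.
End Curry.

Section Cancel.
Variables (C D : Bicat) (K : TwoCat).

Lemma rowsK : cancel (@rows C D K) (@of_rows C D K).
Proof. by case=> *; apply: bilax_ext => *; [|apply: lax_on_ext|]. Qed.

Lemma colsK : cancel (@cols C D K) (@of_cols C D K).
Proof. by case=> *; apply: bilax_ext => *; [apply: lax_on_ext| |]. Qed.

Lemma of_rowsK : cancel (@of_rows C D K) (@rows C D K).
Proof.
case=> G; have [G0 [G1 ->]] := lax_functor_eta G => on.
apply: (f_equal (@Build_LaxFunctor D (Lax_l C K) _)).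
by apply: lax_on_ext_l => *; rewrite /lm_eval /=.
Qed.

Lemma of_colsK : cancel (@of_cols C D K) (@cols C D K).
Proof.
case=> G; have [G0 [G1 ->]] := lax_functor_eta G => on.
apply: (f_equal (@Build_LaxFunctor C (Lax_c D K) _)).
by apply: lax_on_ext_c => *; rewrite /om_eval /=.
Qed.

End Cancel.

(** * 2-functors as strict lax functors *)

Lemma invertible_cast_id2 (X : HomCats) (A B : ob X) (f g h : hom A B) (e : f = g) (e' : f = h) :
  invertible (cast e e' (id2 f)).
Proof. by case: _ / e; case: _ / e'; exists (id2 f); rewrite /= vcomp_idl. Qed.

(** The constraints are identities, transported along the strict laws.  This lets
    the currying above apply when one of the variables is a 2-category. *)
Definition bicat_of (A : TwoCat) : Bicat.
Proof.
unshelve refine (@Build_Bicat A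
  (fun a b f => cast eq_refl (comp1l f) (id2 _)) (fun a b f => cast eq_refl (comp1r f) (id2 _))
  (fun a b c d h g f => cast eq_refl (compA h g f) (id2 _)) _ _ _ _ _ _ _ _).
- by move=> *; apply: invertible_cast_id2.
- by move=> *; apply: invertible_cast_id2.
- by move=> *; apply: invertible_cast_id2.
- by move=> a b f f' x; apply: pack_inj; pk; rewrite hT1l vT1l ?vT1r //= comp1l.
- by move=> a b f f' x; apply: pack_inj; pk; rewrite hT1r vT1l ?vT1r //= comp1r.
- by move=> a b c d h h' g g' f f' z y x; apply: pack_inj; pk; rewrite hTA vT1l ?vT1r //= compA.
- move=> a b c g f; apply: pack_inj; pk.
  by rewrite !hT_id vT1r //= comp1l compA comp1l.
- move=> a b c d e k h g f; apply: pack_inj; pk.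
  by rewrite !hT_id !vT1r //= ?compA.
Defined.

(** Composition with [lax_id A] regards a 2-functor on [A] as a lax functor. *)
Definition lax_id (A : TwoCat) : LaxFunctor (bicat_of A) A.
Proof.
unshelve refine (@Build_LaxFunctor (bicat_of A) A (fun a => a)
  (@Build_LaxOn (bicat_of A) A (fun a => a) (fun a b f => f) (fun a b f g x => x)
     (fun a => id2 _) (fun a b c g f => id2 _) _ _ _ _ _ _)).
- by [].
- by [].
- by move=> *; rewrite vcomp_idl vcomp_idr.
- move=> a b c d h g f; pk.
  by rewrite /= !hT_id !vT1l ?vT1r //= compA.
- move=> a b f; pk.
  by rewrite /= !hT_id !vT1l ?vT1r //= comp1l.
- move=> a b f; pk.
  by rewrite /= !hT_id !vT1l ?vT1r //= comp1r.
Defined.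

Section Strict.
Variables (A K : TwoCat) (F0 : ob A -> ob K).

(** Identity structure 2-cells, up to boundary: as such it already contains the
    preservation of identities and composites of 1-cells. *)
Definition strict (F : @LaxOn (bicat_of A) K F0) : Prop :=
  (forall a, lunit F a ≡ id2 (id1 (F0 a))) /\
  (forall a b c (g : @hom A b c) (f : @hom A a b), lmult F g f ≡ id2 (lf1 F g ∘ lf1 F f)).

Lemma strict_id1 (F : @LaxOn (bicat_of A) K F0) (s : strict F) (a : ob A) :
  lf1 F (@id1 A a) = id1 (F0 a).
Proof. exact: (f_equal (@tgt _ _ _) (proj1 s a)). Qed.

Lemma strict_comp (F : @LaxOn (bicat_of A) K F0) (s : strict F) (a b c : ob A)
    (g : hom b c) (f : hom a b) :
  @lf1 _ _ _ F a c (g ∘ f) = @lf1 _ _ _ F b c g ∘ @lf1 _ _ _ F a b f.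
Proof. exact: (f_equal (@tgt _ _ _) (proj2 s a b c g f)). Qed.

Definition two_fun_of_strict (F : @LaxOn (bicat_of A) K F0) (s : strict F) : TwoFunOn F0.
Proof.
unshelve refine (@Build_TwoFunOn A K F0 (fun a b f => @lf1 _ _ _ F a b f)
  (fun a b f g x => @lf2 _ _ _ F a b f g x) (strict_id1 s) (strict_comp s) _ _ _).
- by move=> *; apply: (@lf2_id _ _ _ F).
- by move=> *; apply: (@lf2_vcomp _ _ _ F).
- move=> a b c g g' f f' y x.
  move: (f_equal pack (@lmult_natural _ _ _ F _ _ _ _ _ _ _ y x)); pk.
  move: (proj2 s a b c g f) (proj2 s a b c g' f'); pk => -> ->.
  by rewrite vT1r ?vT1l //=; exact: (strict_comp s).
Defined.

(** Together with [strict_comp_on] and [comp_on_lax_id_inj], this identifies strict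
    lax functors with 2-functors, over a fixed map on objects. *)
Lemma comp_on_lax_id (F : @LaxOn (bicat_of A) K F0) (s : strict F) :
  comp_on (two_fun_of_strict s) (lfon (lax_id A)) = F.
Proof.
apply: lax_on_ext => [||a|a b c g f].
- reflexivity.
- reflexivity.
- rewrite pack_cast tf2_id; apply: etrans (esym (proj1 s a)).
  exact: (f_equal (@iT _ _ _) (strict_id1 s a)).
- rewrite pack_cast tf2_id; apply: etrans (esym (proj2 s a b c g f)).
  exact: (f_equal (@iT _ _ _) (strict_comp s g f)).
Qed.

Lemma strict_comp_on (G : TwoFunOn F0) : strict (comp_on G (lfon (lax_id A))).
Proof.
split=> [a|a b c g f] /=; pk.
- by rewrite tf2_id iTE tf1_id.
- by rewrite tf2_id iTE tf1_comp.
Qed.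

Lemma comp_on_lax_id_inj (G G' : TwoFunOn F0) :
  comp_on G (lfon (lax_id A)) = comp_on G' (lfon (lax_id A)) -> G = G'.
Proof.
move=> e; apply: two_fun_on_ext => [a b f|a b f g x].
- exact: (f_equal (fun F => lf1 F (f : @hom (bicat_of A) a b)) e).
- exact: (f_equal (fun F => pack (lf2 F (x : @cell (bicat_of A) a b f g))) e).
Qed.
End Strict.

Lemma comp_lax_id_inj (A K : TwoCat) :
  injective (fun G : TwoFunctor A K => comp_lax G (lax_id A)).
Proof.
case=> [F0 F] [G0 G] e.
have e0 : F0 = G0 by exact: (f_equal (@lfob _ _) e).
case: _ / e0 G e => G e.
by have /= -> := comp_on_lax_id_inj (lax_functor_inj e).
Qed.

(** * Objects of the classifier *)

(** 2-functors and lax functors into a codiscrete 2-category are just maps on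
    objects, so the universal property of a classifier, applied to these
    2-categories, says that its object map is bijective. *)
Definition codiscrete (X : Type) : TwoCat.
Proof.
unshelve refine (@Build_TwoCat (@Build_HomCats X (fun _ _ => unit) (fun _ _ _ _ => unit)
  (fun _ _ _ => tt) (fun _ _ _ _ _ _ _ => tt) (fun _ => tt) (fun _ _ _ _ _ => tt)
  (fun _ _ _ _ _ _ _ _ _ => tt) _ _ _ _ _) _ _ _ _ _ _) => //=.
all: first [by move=> * | by move=> ? ? [] | by move=> ? ? ? ? [] | by move=> ? ? [] [] []].
Defined.

Definition to_codiscrete (A : TwoCat) (X : Type) (h : ob A -> X) : TwoFunctor A (codiscrete X).
Proof.
by unshelve refine (@Build_TwoFunctor A (codiscrete X) h (@Build_TwoFunOn A (codiscrete X) h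
  (fun _ _ _ => tt) (fun _ _ _ _ _ => tt) _ _ _ _ _)).
Defined.

Lemma lax_to_codiscrete_ext (C : Bicat) (X : Type) (F G : LaxFunctor C (codiscrete X)) :
  lfob F = lfob G -> F = G.
Proof.
case: F G => [F0 F] [G0 G] /= e; case: _ / e G => G; congr Build_LaxFunctor.
apply: lax_on_ext => [a b f|a b f g x|a|a b c g f].
- by case: (lf1 F f); case: (lf1 G f).
- move: (lf2 F x) (lf2 G x).
  by case: (lf1 F f); case: (lf1 F g); case: (lf1 G f); case: (lf1 G g); case; case.
- move: (lunit F a) (lunit G a).
  by case: (lf1 F (id1 a)); case: (lf1 G (id1 a)); case; case.
- move: (lmult F g f) (lmult G g f).
  case: (lf1 F (g ∘ f)); case: (lf1 G (g ∘ f)).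
  by case: (lf1 F f); case: (lf1 F g); case: (lf1 G f); case: (lf1 G g); case; case.
Qed.

(** The classifying lax functor cannot miss an object: otherwise the indicator of
    its image and the constant map would be distinct 2-functors into a codiscrete
    2-category with the same restriction. *)
Lemma cl_surjective (C : Bicat) (Cb : LaxClassifier C) (a : ob Cb) : exists c, cl Cb c = a.
Proof.
pose hit (a : ob Cb) : bool :=
  match excluded_middle_informative (exists c, cl Cb c = a) with
  | left _ => true
  | right _ => false
  end.
have /bij_inj inj := cl_universal Cb (codiscrete bool).
have /(f_equal (fun G : TwoFunctor _ (codiscrete bool) => (tfob G a : bool))) :
    to_codiscrete hit = to_codiscrete (fun=> true).
  apply: inj; apply: lax_to_codiscrete_ext; apply: functional_extensionality => c /=.
  by rewrite /hit; case: excluded_middle_informative => // n; case: n; exists c.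
by rewrite /= /hit; case: excluded_middle_informative.
Qed.

(** * Currying interpretations of the Gray generators *)

Section OfGray.
Variables (C D : Bicat) (A B K : TwoCat).
Variables (P : LaxFunctor C A) (Q : LaxFunctor D B) (u : GrayData A B K).

(** Unlike [of_rows (curry_l P Q u)], to which it is equal, this has both families
    of lax functors literally those of [u]. *)
Definition bilax_of_gray : Bilax C D K.
Proof.
unshelve refine (@Build_Bilax C D K (fun c d => gob u (P c) (Q d))
    (fun d => comp_on (gl u (Q d)) (lfon P)) (fun c => comp_on (gr u (P c)) (lfon Q))
    (fun c c' d d' f g => gam u (lf1 (lfon P) f) (lf1 (lfon Q) g)) _ _ _ _ _ _).
- by move=> c c' d d' f f' g x; apply: pack_inj; pk; rewrite gam_nat_l.
- by move=> c d d' g; pk; rewrite gam_nat_l gam_id_l; pk; rewrite vT1r //= tf1_id comp1r.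
- by move=> c c' c'' d d' f' f g; pk; rewrite gam_nat_l gam_comp_l; pk.
- by move=> c c' d d' f g g' y; apply: pack_inj; pk; rewrite gam_nat_r.
- by move=> c c' d f; pk; rewrite gam_nat_r gam_id_r; pk; rewrite vT1r //= tf1_id comp1l.
- by move=> c c' d d' d'' f g' g; pk; rewrite gam_nat_r gam_comp_r; pk.
Defined.

Lemma rows_of_gray : rows bilax_of_gray = curry_l P Q u.
Proof.
rewrite /rows /curry_l.
apply: (f_equal (@Build_LaxFunctor D (Lax_l C K) (slice_l P Q u))).
by apply: lax_on_ext_l => *; rewrite /lm_eval /=.
Qed.

Lemma cols_of_gray : cols bilax_of_gray = curry_c P Q u.
Proof.
rewrite /cols /curry_c.
apply: (f_equal (@Build_LaxFunctor C (Lax_c D K) (slice_r P Q u))).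
by apply: lax_on_ext_c => *; rewrite /om_eval /=.
Qed.
End OfGray.

Section StrictCurry.
Variables (C : Bicat) (A B K : TwoCat) (u : GrayData A B K).

Section Left.
Variable P : LaxFunctor C A.
Let trans (b b' : ob B) (g : hom b b') :=
  @slice_l_trans C (bicat_of B) A B K P (lax_id B) u b b' g.
Let obj (b : ob B) := @slice_l C (bicat_of B) A B K P (lax_id B) u b.

Lemma slice_l_trans_id1 (b : ob B) : trans (id1 b) = lt_id (obj b).
Proof.
apply: lt_ext => [c|c c' f] /=; first exact: tf1_id.
by pk; rewrite gam_id_r.
Qed.

Lemma slice_l_trans_comp (b b' b'' : ob B) (g' : hom b' b'') (g : hom b b') :
  trans (g' ∘ g) = lt_comp (trans g') (trans g).
Proof.
apply: lt_ext => [c|c c' f] /=; first exact: tf1_comp.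
by pk; rewrite gam_comp_r; pk.
Qed.

(** When the second variable is restricted along the identity only, currying keeps
    its strictness: the result is a 2-functor. *)
Definition two_curry_l_on : @TwoFunOn B (Lax_l C K) obj.
Proof.
unshelve refine (@Build_TwoFunOn B (Lax_l C K) obj trans
  (fun b b' g g' y => @slice_l_mod C (bicat_of B) A B K P (lax_id B) u b b' g g' y)
  slice_l_trans_id1 slice_l_trans_comp _ _ _).
- by move=> b b' g; apply: lm_ext => c; apply: tf2_id.
- by move=> *; apply: lm_ext => c; apply: tf2_vcomp.
- move=> b b' b'' g g' f f' y x; apply: lm_packE => [||c].
  + exact: slice_l_trans_comp.
  + exact: slice_l_trans_comp.
  + exact: tf2_hcomp.
Defined.

Definition two_curry_l : TwoFunctor B (Lax_l C K) := Build_TwoFunctor two_curry_l_on.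
End Left.

Section Right.
Variable Q : LaxFunctor C B.
Let trans (a a' : ob A) (f : hom a a') :=
  @slice_r_trans (bicat_of A) C A B K (lax_id A) Q u a a' f.
Let obj (a : ob A) := @slice_r (bicat_of A) C A B K (lax_id A) Q u a.

Lemma slice_r_trans_id1 (a : ob A) : trans (id1 a) = ot_id (obj a).
Proof.
apply: ot_ext => [d|d d' g] /=; first exact: (tf1_id (gl u (Q d))).
by pk; rewrite gam_id_l.
Qed.

Lemma slice_r_trans_comp (a a' a'' : ob A) (f' : hom a' a'') (f : hom a a') :
  trans (f' ∘ f) = ot_comp (trans f') (trans f).
Proof.
apply: ot_ext => [d|d d' g] /=; first exact: (tf1_comp (gl u (Q d))).
by pk; rewrite gam_comp_l; pk.
Qed.

Definition two_curry_c_on : @TwoFunOn A (Lax_c C K) obj.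
Proof.
unshelve refine (@Build_TwoFunOn A (Lax_c C K) obj trans
  (fun a a' f f' x => @slice_r_mod (bicat_of A) C A B K (lax_id A) Q u a a' f f' x)
  slice_r_trans_id1 slice_r_trans_comp _ _ _).
- by move=> a a' f; apply: om_ext => d; apply: (tf2_id (gl u (Q d))).
- by move=> *; apply: om_ext => d; apply: (tf2_vcomp (gl u (Q d))).
- move=> a a' a'' g g' f f' y x; apply: om_packE => [||d].
  + exact: slice_r_trans_comp.
  + exact: slice_r_trans_comp.
  + exact: (tf2_hcomp (gl u (Q d))).
Defined.

Definition two_curry_c : TwoFunctor A (Lax_c C K) := Build_TwoFunctor two_curry_c_on.
End Right.
End StrictCurry.

Section Extend.
Variables (C D : Bicat) (A B K : TwoCat) (u : GrayData A B K).
Variables (P : LaxFunctor C A) (Q : LaxFunctor D B).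

(** Currying before or after restriction along [Q] gives the same lax functor;
    hence, when [Q] is a classifying lax functor, its universal property governs
    the restriction of [u] along [Q]. *)
Lemma two_curry_lE : comp_lax (two_curry_l u P) Q = curry_l P Q u.
Proof.
have e : comp_on (two_curry_l_on u P) Q = lfon (curry_l P Q u).
  by apply: lax_on_ext_l => * //=; rewrite pack_cast /lm_eval /= pack_cast.
exact: (f_equal (@Build_LaxFunctor D (Lax_l C K) (slice_l P Q u)) e).
Qed.

Lemma two_curry_cE : comp_lax (two_curry_c u Q) P = curry_c P Q u.
Proof.
have e : comp_on (two_curry_c_on u Q) P = lfon (curry_c P Q u).
  by apply: lax_on_ext_c => * //=; rewrite pack_cast /om_eval /= pack_cast.
exact: (f_equal (@Build_LaxFunctor C (Lax_c D K) (slice_r P Q u)) e).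
Qed.
End Extend.

(** * Interpretations from 2-functors with strict values *)

Lemma lt_comp_cellE (C : Bicat) (K : TwoCat) (F G H : LaxFunctor C K) (t : LaxTrans G H)
    (s : LaxTrans F G) (A B : ob C) (f : hom A B) :
  pack (lt_cell (lt_comp t s) f)
  = vT (hT (iT (t B)) (pack (lt_cell s f))) (hT (pack (lt_cell t f)) (iT (s A))).
Proof. by rewrite /=; pk. Qed.

(** The inverse of [two_curry_l u (lax_id A)], for a 2-functor whose values are given
    as 2-functors [h1 b].  In [gray_of_gr] and the two compatibilities of
    [gray_of_gam] with [B], an equation between transformations is evaluated; the
    two compatibilities with [A] are the axioms of the transformation [tf1 G g]. *)
Section GrayOf.
Variables (A B K : TwoCat) (h0 : ob B -> ob A -> ob K) (h1 : forall b, TwoFunOn (h0 b)).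
Let val (b : ob B) : LaxFunctor (bicat_of A) K :=
  Build_LaxFunctor (comp_on (h1 b) (lfon (lax_id A))).
Variable G : @TwoFunOn B (Lax_l (bicat_of A) K) val.

Definition gray_of_gr (a : ob A) : @TwoFunOn B K (fun b => h0 b a).
Proof.
unshelve refine (@Build_TwoFunOn B K (fun b => h0 b a)
  (fun b b' g => lt_at (tf1 G g) a) (fun b b' g g' y => lm_at (tf2 G y) a) _ _ _ _ _).
- by move=> b; exact: (f_equal (fun t : LaxTrans (val b) (val b) => lt_at t a) (tf1_id G b)).
- move=> b b' b'' g' g.
  exact: (f_equal (fun t : LaxTrans (val b) (val b'') => lt_at t a) (tf1_comp G g' g)).
- move=> b b' g.
  exact: (f_equal (fun m : LaxMod (tf1 G g) (tf1 G g) => lm_at m a) (tf2_id G g)).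
- move=> b b' g g' g'' y' y.
  exact: (f_equal (fun m : LaxMod (tf1 G g) (tf1 G g'') => lm_at m a) (tf2_vcomp G y' y)).
- move=> b b' b'' g g' f f' y x.
  exact: (f_equal (fun m : @Cell (Lax_l _ K) (val b) (val b'') => lm_eval m a) (tf2_hcomp G y x)).
Defined.

Let gray_of_gam (a a' : ob A) (b b' : ob B) (f : hom a a') (g : hom b b') :
    cell (tf1 (h1 b') f ∘ tf1 (gray_of_gr a) g) (tf1 (gray_of_gr a') g ∘ tf1 (h1 b) f) :=
  @lt_cell _ _ _ _ (tf1 G g) a a' f.

Lemma gray_of_id_l (a : ob A) (b b' : ob B) (g : hom b b') :
  gray_of_gam (id1 a) g ≡ id2 (tf1 (gray_of_gr a) g).
Proof.
move: (lt_unit (tf1 G g) a) => /=; pk; rewrite !tf2_id !iTE.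
by rewrite !hT_id vT1r // => ->; rewrite tf1_id comp1r.
Qed.

Lemma gray_of_id_r (a a' : ob A) (b : ob B) (f : hom a a') :
  gray_of_gam f (id1 b) ≡ id2 (tf1 (h1 b) f).
Proof.
apply: etrans (f_equal (fun t : LaxTrans (val b) (val b) => pack (lt_cell t f)) (tf1_id G b)) _.
by rewrite /=; pk.
Qed.

Lemma gray_of_comp_l (a a' a'' : ob A) (b b' : ob B)
    (f' : hom a' a'') (f : hom a a') (g : hom b b') :
  gray_of_gam (f' ∘ f) g
  ≡ (gray_of_gam f' g ▷ tf1 (h1 b) f) •[eq_sym (compA _ _ _)]
      (tf1 (h1 b') f' ◁ gray_of_gam f g).
Proof.
move: (lt_mult (tf1 G g) f' f) => /=; pk.
rewrite !tf2_id !iTE !hT_id vT1r // => ->; rewrite vT1l //; bdy.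
by rewrite tf1_comp.
Qed.

Lemma gray_of_comp_r (a a' : ob A) (b b' b'' : ob B)
    (f : hom a a') (g' : hom b' b'') (g : hom b b') :
  gray_of_gam f (g' ∘ g)
  ≡ (tf1 (gray_of_gr a') g' ◁ gray_of_gam f g) •[compA _ _ _]
      (gray_of_gam f g' ▷ tf1 (gray_of_gr a) g).
Proof.
have e := f_equal (fun t : LaxTrans (val b) (val b'') => pack (lt_cell t f)) (tf1_comp G g' g).
by pk; exact: etrans e (lt_comp_cellE (tf1 G g') (tf1 G g) f).
Qed.

(** Interchange reduces the joint naturality to the naturality of [tf1 G g'] in [x]
    and the modification equation of [tf2 G y]. *)
Lemma gray_of_natural (a a' : ob A) (b b' : ob B) (f f' : hom a a') (g g' : hom b b')
    (x : cell f f') (y : cell g g') :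
  gray_of_gam f' g' • (tf2 (h1 b') x ∗ tf2 (gray_of_gr a) y)
  = (tf2 (gray_of_gr a') y ∗ tf2 (h1 b) x) • gray_of_gam f g.
Proof.
apply: pack_inj; pk.
move: (f_equal pack (lt_natural (tf1 G g') x)) (f_equal pack (lm_natural (tf2 G y) f)).
rewrite /=; pk => ex ey.
rewrite hT_lr [in RHS]hT_rl /=.
rewrite vTA; try by bdy.
rewrite -ex -vTA; try by bdy.
by rewrite -ey vTA; try by bdy.
Qed.

Definition gray_of : GrayData A B K :=
  @Build_GrayData A B K (fun a b => h0 b a) h1 gray_of_gr (@gray_of_gam)
    gray_of_id_l gray_of_id_r gray_of_comp_l gray_of_comp_r gray_of_natural.
End GrayOf.

Lemma gray_data_ext (A B K : TwoCat) (o : ob A -> ob B -> ob K)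
    (l : forall b, TwoFunOn (fun a => o a b)) (r r' : forall a, TwoFunOn (fun b => o a b))
    g i1 i2 i3 i4 i5 g' j1 j2 j3 j4 j5 :
  (forall a, r a = r' a) ->
  (forall a a' b b' (f : hom a a') (h : hom b b'), g a a' b b' f h ≡ g' a a' b b' f h) ->
  @Build_GrayData A B K o l r g i1 i2 i3 i4 i5 = @Build_GrayData A B K o l r' g' j1 j2 j3 j4 j5.
Proof.
move=> er; have {}er : r = r' by fext.
case: _ / er g' j1 j2 j3 j4 j5 => g' j1 j2 j3 j4 j5 eg.
have {}eg : g = g' by fext; apply: pack_inj.
case: _ / eg j1 j2 j3 j4 j5 => *.
by f_equal; apply: proof_irrelevance.
Qed.

Section Universal.
Variables (A B K : TwoCat).

(** The components of [u] can be read off the curried form, in an order in which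
    the types of later components are fixed by the earlier ones: [gob] from its
    objects, [gl] from their structure, [gr] and [gam] from its 1- and 2-cells. *)
Lemma two_curry_l_inj : injective (fun u : GrayData A B K => two_curry_l u (lax_id A)).
Proof.
case=> [o l r g i1 i2 i3 i4 i5] [o' l' r' g' j1 j2 j3 j4 j5] e.
have eo : o = o'.
  exact: (f_equal (fun F : TwoFunctor B (Lax_l (bicat_of A) K) =>
    fun a b => lfob (tfob F b) a) e).
case: _ / eo l' r' g' j1 j2 j3 j4 j5 e => l' r' g' j1 j2 j3 j4 j5 e.
have el : l = l'.
  apply: functional_extensionality_dep => b.
  apply: comp_on_lax_id_inj; apply: lax_functor_inj.
  exact: (f_equal (fun F : TwoFunctor B (Lax_l (bicat_of A) K) => tfob F b) e).
case: _ / el r' g' j1 j2 j3 j4 j5 e => r' g' j1 j2 j3 j4 j5 e.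
have {}e := two_functor_inj e.
pose val b : LaxFunctor (bicat_of A) K := Build_LaxFunctor (comp_on (l b) (lfon (lax_id A))).
have e1 b b' (h : hom b b') :=
  f_equal (fun F : @TwoFunOn B (Lax_l (bicat_of A) K) val => tf1 F h) e.
apply: gray_data_ext => [a|a a' b b' f h].
- apply: two_fun_on_ext => [b b' h|b b' h h' y].
  + exact: (f_equal (fun t : LaxTrans (val b) (val b') => lt_at t a) (e1 b b' h)).
  + exact: (f_equal (fun F : @TwoFunOn B (Lax_l (bicat_of A) K) val =>
      lm_eval (pack (tf2 F y)) a) e).
- exact: (f_equal (fun t : LaxTrans (val b) (val b') => pack (lt_cell t f)) (e1 b b' h)).
Qed.

Lemma two_curry_l_gray_of (h0 : ob B -> ob A -> ob K) (h1 : forall b, TwoFunOn (h0 b)) G :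
  two_curry_l (@gray_of A B K h0 h1 G) (lax_id A) = Build_TwoFunctor G.
Proof.
apply: (f_equal (@Build_TwoFunctor B (Lax_l (bicat_of A) K) _)).
by apply: two_fun_on_ext_l => *; reflexivity.
Qed.

(** Strictness is used to replace each value by a 2-functor, after which the object
    map has the form required by [gray_of]. *)
Lemma two_curry_l_surj (G : TwoFunctor B (Lax_l (bicat_of A) K)) :
  (forall b, strict (lfon (G b : LaxFunctor (bicat_of A) K))) ->
  exists u, two_curry_l u (lax_id A) = G.
Proof.
case: G => G0 G s; have [h0 [h1 e]] := lax_functor_eta G0.
case: _ / (esym e) G s => G /= s.
pose k b := two_fun_of_strict (s b).
have ek : h1 = fun b => comp_on (k b) (lfon (lax_id A)).
  by apply: functional_extensionality_dep => b; rewrite comp_on_lax_id.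
clearbody k; clear s; case: _ / (esym ek) G => G.
by exists (gray_of G); apply: two_curry_l_gray_of.
Qed.
End Universal.

(** * Extension along the classifying lax functors *)

Lemma strict_of_cols (D : Bicat) (A K : TwoCat) (H : LaxFunctor (bicat_of A) (Lax_c D K))
  (d : ob D) : strict (lfon H) -> strict (of_cols_bl H d).
Proof.
case=> su sm; split=> [a|a b c g f]; first exact: (f_equal (fun x => om_eval x d) (su a)).
exact: (f_equal (fun x => om_eval x d) (sm a b c g f)).
Qed.

Section Classified.
Variables (C D : Bicat) (K : TwoCat) (Cb : LaxClassifier C) (Db : LaxClassifier D).

(** A 2-functor [A -> Lax_c D K] determines its columns, hence its rows, hence by
    the universal property of the classifier of [D] its extension in the second
    variable. *)
Lemma two_curry_c_inj (A : TwoCat) :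
  injective (fun u : GrayData A Db K => two_curry_c u (cl Db)).
Proof.
move=> u u' /(f_equal (fun G => comp_lax G (lax_id A))).
rewrite !two_curry_cE -!cols_of_gray => /(can_inj (@colsK _ _ _)) /(f_equal (@rows _ _ _)).
rewrite !rows_of_gray -!two_curry_lE => /(bij_inj (cl_universal Db (Lax_l (bicat_of A) K))).
exact: two_curry_l_inj.
Qed.

(** Recurry, extend along the second variable, and recurry back. *)
Lemma two_curry_c_surj (A : TwoCat) (H : TwoFunctor A (Lax_c D K)) :
  exists u : GrayData A Db K, two_curry_c u (cl Db) = H.
Proof.
pose w := of_cols (comp_lax H (lax_id A)).
have [ext _ extK] := cl_universal Db (Lax_l (bicat_of A) K).
pose G := ext (rows w).
have eG : comp_lax G (cl Db) = rows w by exact: extK.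
have s b : strict (lfon (tfob G b)).
  (* Strictness need only be checked at objects coming from D, where the value is
     a row of [w], which is strict because [H] is a 2-functor. *)
  have [d <-] := cl_surjective b.
  have -> : tfob G (cl Db d) = row w d.
    exact: (f_equal (fun F : LaxFunctor D (Lax_l (bicat_of A) K) => lfob F d) eG).
  exact: (@strict_of_cols D A K (comp_lax H (lax_id A)) d (strict_comp_on (tfon H))).
have [u eu] := two_curry_l_surj s.
exists u; apply: comp_lax_id_inj => /=.
rewrite two_curry_cE -cols_of_gray -[RHS](@of_colsK (bicat_of A) D K); congr (cols _).
apply: (can_inj (@rowsK _ _ _)).
by rewrite rows_of_gray -two_curry_lE eu.
Qed.

Lemma two_curry_c_bij (A : TwoCat) :
  bijective (fun u : GrayData A Db K => two_curry_c u (cl Db)).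
Proof. exact: inj_surj_bij (@two_curry_c_inj A) (@two_curry_c_surj A). Qed.

Lemma curry_c_bij : bijective (fun u : GrayData Cb Db K => curry_c (cl Cb) (cl Db) u).
Proof.
have bij := bij_comp (cl_universal Cb (Lax_c D K)) (two_curry_c_bij Cb).
by apply: (eq_bij bij) => u; apply: two_curry_cE.
Qed.

(** Recurrying [curry_c] through [Bilax] gives [curry_l]. *)
Lemma curry_l_bij : bijective (fun u : GrayData Cb Db K => curry_l (cl Cb) (cl Db) u).
Proof.
have bij := bij_comp (Bijective (@rowsK C D K) (@of_rowsK C D K))
  (bij_comp (Bijective (@of_colsK C D K) (@colsK C D K)) curry_c_bij).
apply: (eq_bij bij) => u /=.
by rewrite -cols_of_gray colsK rows_of_gray.
Qed.
End Classified.

Lemma gray_map_bij (A B K : TwoCat) (T : GrayTensor A B) :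
  bijective (fun F : TwoFunctor T K => gray_map F (tensor_data T)).
Proof.
apply: inj_surj_bij => [F F' e|v].
- have [G [_ uG]] := tensor_universal T (gray_map F' (tensor_data T)).
  by rewrite -(uG F e) -(uG F' erefl).
- by have [F [eF _]] := tensor_universal T v; exists F.
Qed.

Theorem proposition5p2p2 (C D : Bicat) (K : TwoCat)
  (Cbar : LaxClassifier C) (Dbar : LaxClassifier D) (T : GrayTensor Cbar Dbar) :
  bijective (fun Gamma : GenDistLaw K T => law_to_lax_l Gamma : LaxFunctor D (Lax_l C K)) /\
  bijective (fun Gamma : GenDistLaw K T => law_to_lax_c Gamma : LaxFunctor C (Lax_c D K)) /\
  (exists Phi : LaxFunctor D (Lax_l C K) -> LaxFunctor C (Lax_c D K),
     bijective Phi /\ forall Gamma : GenDistLaw K T, Phi (law_to_lax_l Gamma) = law_to_lax_c Gamma).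
Proof.
split; first exact: bij_comp (curry_l_bij K Cbar Dbar) (gray_map_bij K T).
split; first exact: bij_comp (curry_c_bij K Cbar Dbar) (gray_map_bij K T).
exists (fun H => cols (of_rows H)); split=> [|Gamma].
- exact: bij_comp (Bijective (@colsK C D K) (@of_colsK C D K))
    (Bijective (@of_rowsK C D K) (@rowsK C D K)).
- by rewrite /law_to_lax_l -rows_of_gray rowsK cols_of_gray.
Qed.
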